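(* Let $(R,\mathfrak m)$ be a quasi-local integral domain (not necessarily noetherian) with unique maximal ideal $\mathfrak m$ such that its $R$-completion $\widetilde R$ is a coherent ring. Then $\operatorname{w.dim}(R)=\operatorname{w.dim}(\widetilde R)$.
   Context: For an integral domain $R$ with fraction field $Q$, $\widetilde R$ denotes the completion of $R$ in the $R$-topology, $\widetilde R=\varprojlim_{0\ne r\in R}R/rR$; it is a commutative ring, identified with $\operatorname{End}_R(Q/R)$. A ring $A$ is coherent if every finitely generated submodule of a finitely presented $A$-module is finitely presented. The weak dimension of a ring $A$ is $\operatorname{w.dim}(A)=\sup\{\operatorname{fd}_A(M): M \text{ an } A\text{-module}\}$, where $\operatorname{fd}_A$ is flat dimension. *)

(* Defs.v *)
From HB Require Import structures.
From mathcomp Require Import all_boot all_order all_algebra.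
From mathcomp Require Import boolp classical_sets constructive_ereal.

Set Implicit Arguments.
Unset Strict Implicit.
Unset Printing Implicit Defensive.

Import Order.TTheory GRing.Theory Num.Theory.

Local Open Scope ring_scope.
Local Open Scope quotient_scope.

(* Rings are allowed to be zero (comPzRingType): the completion of a field is
   the zero ring, and R/rR is zero when r is a unit. *)

Section Tensor.
Variables (A : comPzRingType) (M N : lmodType A).

Definition bilinear_map (P : lmodType A) (b : M -> N -> P) :=
  (forall n, linear (b^~ n)) /\ (forall m, linear (b m)).

(* A list of pairs stands for the formal sum of its elements; no formal
   opposites are needed because -(m (x) n) = (-m) (x) n. *)
Inductive tensor_eq : seq (M * N) -> seq (M * N) -> Prop :=
| TensorRefl s : tensor_eq s s
| TensorSym s t : tensor_eq s t -> tensor_eq t s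
| TensorTrans s t u : tensor_eq s t -> tensor_eq t u -> tensor_eq s u
| TensorCat s s' t t' :
    tensor_eq s s' -> tensor_eq t t' -> tensor_eq (s ++ t) (s' ++ t')
| TensorCatC s t : tensor_eq (s ++ t) (t ++ s)
| Tensor0 n : tensor_eq [:: (0, n)] [::]
| TensorDl m m' n : tensor_eq [:: (m + m', n)] [:: (m, n); (m', n)]
| TensorDr m n n' : tensor_eq [:: (m, n + n')] [:: (m, n); (m, n')]
| TensorZ a m n : tensor_eq [:: (a *: m, n)] [:: (m, a *: n)].

Definition tensor_eqb (s t : seq (M * N)) : bool := `[< tensor_eq s t >].

Lemma tensor_eqb_equiv : equiv_class_of tensor_eqb.
Proof.
split=> [s|s t|t s u]; first exact/asboolP/TensorRefl.
  by apply/asboolP/asboolP; exact: TensorSym.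
by move=> /asboolP st /asboolP tu; apply/asboolP/(TensorTrans st tu).
Qed.

Canonical tensor_eqb_equivRel := EquivRelPack tensor_eqb_equiv.

Definition tensor : Type := {eq_quot tensor_eqb}.
HB.instance Definition _ := Choice.on tensor.
HB.instance Definition _ := EqQuotient.on tensor.

Lemma eqtensP (s t : seq (M * N)) :
  \pi_tensor s = \pi_tensor t <-> tensor_eq s t.
Proof.
split=> [st|st]; last exact/(eqquotP tensor)/asboolP.
exact/asboolP/(eqquotP tensor).
Qed.

Lemma repr_tensor (s : seq (M * N)) : tensor_eq (repr (\pi_tensor s)) s.
Proof. by apply/eqtensP; rewrite reprK. Qed.

Definition scale_seq (a : A) (s : seq (M * N)) := [seq (a *: x.1, x.2) | x <- s].

Lemma scale_seq_eq a s t :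
  tensor_eq s t -> tensor_eq (scale_seq a s) (scale_seq a t).
Proof.
elim=> {s t} /=.
- by move=> s; exact: TensorRefl.
- by move=> s t _; exact: TensorSym.
- by move=> s t u _ st _; exact: TensorTrans.
- by move=> s s' t t' _ ss _ tt; rewrite /scale_seq !map_cat; exact: TensorCat.
- by move=> s t; rewrite /scale_seq !map_cat; exact: TensorCatC.
- by move=> n; rewrite scaler0; exact: Tensor0.
- by move=> m m' n; rewrite scalerDr; exact: TensorDl.
- by move=> m n n'; exact: TensorDr.
- by move=> b m n; rewrite scalerA mulrC -scalerA; exact: TensorZ.
Qed.

Definition tensor_add := lift_op2 tensor (@cat (M * N)).
Definition tensor_scale a := lift_op1 tensor (scale_seq a).
Definition tensor_zero : tensor := \pi_tensor [::].

Lemma tensor_addE s t :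
  tensor_add (\pi_tensor s) (\pi_tensor t) = \pi_tensor (s ++ t).
Proof.
by unlock tensor_add; apply/eqtensP/TensorCat; exact: repr_tensor.
Qed.

Lemma tensor_scaleE a s :
  tensor_scale a (\pi_tensor s) = \pi_tensor (scale_seq a s).
Proof. by unlock tensor_scale; exact/eqtensP/scale_seq_eq/repr_tensor. Qed.

Lemma tensor_addA : associative tensor_add.
Proof.
by move=> x y z; rewrite -[x]reprK -[y]reprK -[z]reprK !tensor_addE catA.
Qed.

Lemma tensor_addC : commutative tensor_add.
Proof.
move=> x y; rewrite -[x]reprK -[y]reprK !tensor_addE.
exact/eqtensP/TensorCatC.
Qed.

Lemma tensor_add0 : left_id tensor_zero tensor_add.
Proof. by move=> x; rewrite -[x]reprK tensor_addE. Qed.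

Lemma tensor_scaleDl x :
  {morph tensor_scale^~ x : a b / a + b >-> tensor_add a b}.
Proof.
move=> a b; rewrite -[x]reprK !tensor_scaleE tensor_addE; apply/eqtensP.
elim: (repr x) => [|[m n] s IH] /=; first exact: TensorRefl.
rewrite -cat1s -[in X in tensor_eq _ X]cat1s.
apply: (@TensorTrans _ (([:: (a *: m, n)] ++ [:: (b *: m, n)]) ++
    (scale_seq a s ++ scale_seq b s))).
  by apply: TensorCat IH; rewrite scalerDl; exact: TensorDl.
rewrite -!catA; apply: TensorCat; first exact: TensorRefl.
rewrite !catA -[X in tensor_eq _ (_ ++ X)]cat1s catA.
by apply: TensorCat; [exact: TensorCatC | exact: TensorRefl].
Qed.

Lemma tensor_scale0 x : tensor_scale 0 x = tensor_zero.
Proof.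
rewrite -[x]reprK tensor_scaleE; apply/eqtensP.
elim: (repr x) => [|[m n] s IH] /=; first exact: TensorRefl.
by rewrite scale0r -cat1s -[[::]]cats0; apply: TensorCat IH; exact: Tensor0.
Qed.

Lemma tensor_scale1 : left_id 1 tensor_scale.
Proof.
move=> x; rewrite -[x]reprK tensor_scaleE; congr (\pi_tensor _).
by rewrite -[RHS]map_id; apply: eq_map => -[m n]; rewrite scale1r.
Qed.

Lemma tensor_addN :
  left_inverse tensor_zero (tensor_scale (-1)) tensor_add.
Proof.
move=> x; rewrite -[X in tensor_add _ X]tensor_scale1 -tensor_scaleDl.
by rewrite addNr tensor_scale0.
Qed.

HB.instance Definition _ := GRing.isZmodule.Build tensor
  tensor_addA tensor_addC tensor_add0 tensor_addN.

Lemma tensor_scaleA a b x :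
  tensor_scale a (tensor_scale b x) = tensor_scale (a * b) x.
Proof.
rewrite -[x]reprK !tensor_scaleE; congr (\pi_tensor _); rewrite /scale_seq -map_comp.
by apply: eq_map => -[m n] /=; rewrite scalerA.
Qed.

Lemma tensor_scaleDr : right_distributive tensor_scale +%R.
Proof.
move=> a x y; rewrite -[x]reprK -[y]reprK.
by rewrite [_ + _]tensor_addE !tensor_scaleE [RHS]tensor_addE /scale_seq map_cat.
Qed.

HB.instance Definition _ := GRing.Zmodule_isLmodule.Build A tensor
  tensor_scaleA tensor_scale1 tensor_scaleDr tensor_scaleDl.

Lemma pi_tensorD s t : \pi_tensor s + \pi_tensor t = \pi_tensor (s ++ t).
Proof. exact: tensor_addE. Qed.

Lemma pi_tensorZ a s : a *: \pi_tensor s = \pi_tensor (scale_seq a s).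
Proof. exact: tensor_scaleE. Qed.

Definition tens (m : M) (n : N) : tensor := \pi_tensor [:: (m, n)].

Lemma tensor_sum (s : seq (M * N)) :
  \pi_tensor s = \sum_(x <- s) tens x.1 x.2.
Proof.
elim: s => [|[m n] s IH]; first by rewrite big_nil.
by rewrite big_cons -IH -cat1s; exact/esym/tensor_addE.
Qed.

Lemma tens_bilinear : bilinear_map tens.
Proof.
split=> [n|m] a u v /=.
  rewrite /tens pi_tensorZ pi_tensorD; apply/eqtensP.
  exact: TensorDl.
rewrite /tens pi_tensorZ pi_tensorD; apply/eqtensP => /=.
apply: (TensorTrans (TensorDr _ _ _)); rewrite -cat1s -[X in tensor_eq _ X]cat1s.
by apply: TensorCat; [exact/TensorSym/TensorZ | exact: TensorRefl].
Qed.

Section Lift.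
Variables (P : lmodType A) (b : M -> N -> P).

Definition tensor_lift (x : tensor) : P := \sum_(p <- repr x) b p.1 p.2.

Hypothesis b_bilin : bilinear_map b.

Lemma tensor_liftE s :
  tensor_lift (\pi_tensor s) = \sum_(p <- s) b p.1 p.2.
Proof.
have bDl m m' n : b (m + m') n = b m n + b m' n.
  by have := b_bilin.1 n 1 m m'; rewrite !scale1r.
have bDr m n n' : b m (n + n') = b m n + b m n'.
  by have := b_bilin.2 m 1 n n'; rewrite !scale1r.
have b0l n : b 0 n = 0 by apply: (addrI (b 0 n)); rewrite -bDl !addr0.
have b0r m : b m 0 = 0 by apply: (addrI (b m 0)); rewrite -bDr !addr0.
suff lift_eq u v : tensor_eq u v ->
    \sum_(p <- u) b p.1 p.2 = \sum_(p <- v) b p.1 p.2.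
  exact: lift_eq (repr_tensor s).
elim=> {s u v} //=.
- by move=> s t u _ -> _ ->.
- by move=> s s' t t' _ ss _ tt; rewrite !big_cat /= ss tt.
- by move=> s t; rewrite !big_cat /= addrC.
- by move=> n; rewrite big_seq1 big_nil /= b0l.
- by move=> m m' n; rewrite !big_cons !big_nil !addr0 /= bDl.
- by move=> m n n'; rewrite !big_cons !big_nil !addr0 /= bDr.
- move=> a m n; rewrite !big_seq1 /=.
  have := b_bilin.1 n a m 0; rewrite addr0 b0l addr0 => ->.
  by have := b_bilin.2 m a n 0; rewrite addr0 b0r addr0 => ->.
Qed.

Lemma tensor_lift_tens m n : tensor_lift (tens m n) = b m n.
Proof. by rewrite tensor_liftE big_seq1. Qed.

Lemma tensor_lift_linear : linear tensor_lift.
Proof.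
move=> a x y; rewrite -[x]reprK -[y]reprK.
rewrite pi_tensorZ pi_tensorD !tensor_liftE big_cat /=.
rewrite scaler_sumr big_map; congr (_ + _); apply: eq_bigr => -[m n] _ /=.
have := b_bilin.1 n a m 0; rewrite addr0 => ->.
suff -> : b 0 n = 0 by rewrite addr0.
have := b_bilin.1 n 1 0 0; rewrite !scale1r !addr0 => h.
by apply: (addrI (b 0 n)); rewrite addr0 -h.
Qed.

End Lift.

Lemma tensor_lift_unique (P : lmodType A) (f g : {linear tensor -> P}) :
  (forall m n, f (tens m n) = g (tens m n)) -> f =1 g.
Proof.
move=> fg x; rewrite -[x]reprK tensor_sum !linear_sum.
by apply: eq_bigr => p _; exact: fg.
Qed.

End Tensor.

Section TensorMap.
Variables (A : comPzRingType) (M N P : lmodType A) (f : {linear N -> P}).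

Let b (m : M) (n : N) : tensor M P := tens m (f n).

Definition tensor_map : tensor M N -> tensor M P := tensor_lift b.

Let b_bilin : bilinear_map b.
Proof.
split=> [n|m] a u v; first exact: (tens_bilinear M P).1.
by rewrite /b linearP; exact: (tens_bilinear M P).2.
Qed.

Lemma tensor_map_tens m n : tensor_map (tens m n) = tens m (f n).
Proof. exact: tensor_lift_tens. Qed.

HB.instance Definition _ := GRing.isLinear.Build A (tensor M N) (tensor M P)
  *:%R tensor_map (tensor_lift_linear b_bilin).

End TensorMap.

Section Dimension.
Variable A : comPzRingType.

Definition flat (M : lmodType A) :=
  forall (N P : lmodType A) (f : {linear N -> P}),
    injective f -> injective (tensor_map f : tensor M N -> tensor M P).

(* An exact sequence 0 -> F_n -> ... -> F_1 -> F_0 -> M -> 0 with all F_i flat,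
   extended by zero modules beyond F_n. *)
Definition has_flat_resolution (M : lmodType A) (n : nat) :=
  exists (F : nat -> lmodType A) (d : forall i, {linear F i.+1 -> F i})
         (e : {linear F 0 -> M}),
    [/\ forall i, flat (F i),
        forall i, (n < i)%N -> forall x : F i, x = 0,
        forall x : M, exists y : F 0, e y = x,
        forall y : F 0, e y = 0 <-> exists z, d 0 z = y
      & forall i (y : F i.+1), d i y = 0 <-> exists z, d i.+1 z = y].

(* Dimensions lie in {0, 1, ...} together with +oo, seen inside \bar int. *)
Definition fd (M : lmodType A) : \bar int :=
  infimum +oo%E [set n%:Z%:E | n in has_flat_resolution M]%classic.

Definition wdim : \bar int :=
  supremum 0%E [set x | exists M : lmodType A, x = fd M]%classic.

Lemma has_flat_resolutionW (M : lmodType A) n p :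
  (n <= p)%N -> has_flat_resolution M n -> has_flat_resolution M p.
Proof.
move=> np [F [d [e [Ff F0 e_surj e_ker d_ker]]]]; exists F, d, e; split=> // i pi.
exact/F0/(leq_ltn_trans np).
Qed.

Lemma fd_spec (M : lmodType A) :
  (exists n, [/\ fd M = n%:Z%:E, has_flat_resolution M n
     & forall p, has_flat_resolution M p -> (n <= p)%N])
  \/ (fd M = +oo%E /\ forall n, ~ has_flat_resolution M n).
Proof.
have [ex|nex] := pselect (exists n, `[< has_flat_resolution M n >]).
  left; case: (ex_minnP ex) => n /asboolP hn nmin; exists n.
  have min p : has_flat_resolution M p -> (n <= p)%N.
    by move=> hp; apply/nmin/asboolP.
  split=> //; rewrite /fd; set E := [set _ | _ in _]%classic.
  have Einf : infimums E n%:Z%:E.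
    split=> [_ [p hp <-]|x]; first by rewrite lee_fin lez_nat min.
    by apply; exists n.
  rewrite /infimum ifF; last first.
    by apply/negP=> /eqP/seteqP[/(_ n%:Z%:E)] E0 _; apply: E0; exists n.
  case: xgetP => [y _ yinf|/(_ n%:Z%:E)//].
  exact: is_subset1_infimums yinf Einf.
right; have nM n : ~ has_flat_resolution M n.
  by move=> hn; apply: nex; exists n; apply/asboolP.
split=> //; rewrite /fd /infimum ifT //; apply/eqP/seteqP.
by split=> // x [n /nM].
Qed.

Lemma fdP (M : lmodType A) (n : nat) :
  (fd M <= n%:Z%:E)%E <-> has_flat_resolution M n.
Proof.
case: (fd_spec M) => [[p [-> hp pmin]]|[-> nM]]; last first.
  by split=> [|/nM].
rewrite lee_fin lez_nat; split=> [pn|/pmin //].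
exact: has_flat_resolutionW hp.
Qed.

Lemma wdimP (n : nat) :
  (wdim <= n%:Z%:E)%E <-> forall M : lmodType A, (fd M <= n%:Z%:E)%E.
Proof.
rewrite /wdim; set E := [set _ | _]%classic.
have E0 : E != set0%classic by apply/set0P; exists (fd A^o), A^o.
have [y ysup] : exists y, supremums E y.
  have [ex|nex] := pselect (exists n, `[< ubound E n%:Z%:E >]).
    case: (ex_minnP ex) => k /asboolP kub kmin; exists k%:Z%:E; split=> //.
    move=> x xub; have [M ME] : exists M, E (fd M) by exists A^o, A^o.
    have := xub _ ME; case: (fd_spec M) => [[p [-> _ _]]|[-> _]].
      case: x xub => [x|//|//] xub; rewrite !lee_fin => px.
      case: x px xub => [x|//] _ xub; rewrite lez_nat.
      exact/kmin/asboolP.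
    by rewrite leye_eq => /eqP ->; rewrite leey.
  exists +oo%E; split=> [x _|[x|//|]]; first exact: leey.
    move=> xub; exfalso; apply: nex; exists `|x|%N; apply/asboolP => z /xub zx.
    by apply: le_trans zx _; rewrite lee_fin abszE ler_norm.
  by move/(_ (fd A^o)) => h; case: (fd_spec A^o) (h (ex_intro _ _ erefl))
     => [[p [-> _ _]]|[-> _]].
rewrite /supremum ifF; last exact/negbTE.
case: xgetP => [z _ [zub zlub]|/(_ y)//]; split=> [zn M|Mn].
  by apply: le_trans zn; apply: zub; exists M.
by apply: zlub => _ [M ->].
Qed.

Definition finitely_generated (M : lmodType A) :=
  exists (n : nat) (f : {linear 'rV[A]_n -> M}), forall x, exists u, f u = x.

Definition finitely_presented (M : lmodType A) :=
  exists (p n : nat) (g : {linear 'rV[A]_p -> 'rV[A]_n})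
         (f : {linear 'rV[A]_n -> M}),
    (forall x, exists u, f u = x) /\
    (forall u, f u = 0 <-> exists v, g v = u).

Definition coherent :=
  forall (M : lmodType A) (S : pred M) (N : subLmodType S),
    finitely_presented M -> finitely_generated N -> finitely_presented N.

End Dimension.

Section MaximalIdeal.
Variable R : comNzRingType.

Definition maximal_ideal (m : {pred R}) :=
  idealr_closed m /\
  forall J : {pred R}, idealr_closed J -> {subset m <= J} -> J =i m.

Definition quasi_local (m : {pred R}) :=
  maximal_ideal m /\ forall n : {pred R}, maximal_ideal n -> n =i m.

End MaximalIdeal.

Section PrincipalQuotient.
Variables (R : comPzRingType) (r : R).

Definition principal : {pred R} := fun x => `[< exists a, x = r * a >].

Lemma principal_zmod_closed : zmod_closed principal.
Proof.
split=> [|x y /asboolP[a ->] /asboolP[b ->]]; apply/asboolP.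
  by exists 0; rewrite mulr0.
by exists (a - b); rewrite mulrBr.
Qed.

HB.instance Definition _ := GRing.isZmodClosed.Build R principal
  principal_zmod_closed.

Lemma principalM a x : x \in principal -> a * x \in principal.
Proof. by move=> /asboolP[b ->]; apply/asboolP; exists (a * b); rewrite mulrCA. Qed.

(* R/rR. The library makes {ideal_quot I} a ring only for proper ideals I. *)
Definition pquot : Type := {ideal_quot principal}.
HB.instance Definition _ := GRing.Zmodule.on pquot.
HB.instance Definition _ := EqQuotient.on pquot.

Lemma pquotP (x y : R) : \pi_pquot x = \pi_pquot y <-> x - y \in principal.
Proof. by split=> [xy|xy]; exact/(eqquotP pquot). Qed.

Lemma repr_pquot (x : R) : repr (\pi_pquot x) - x \in principal.
Proof. by apply/pquotP; rewrite reprK. Qed.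

Lemma pi_pquotD (x y : R) : \pi_pquot (x + y) = \pi_pquot x + \pi_pquot y.
Proof. exact: Quotient.pi_add. Qed.

Definition pquot_mul := lift_op2 pquot *%R.
Definition pquot_one : pquot := \pi_pquot 1.

Lemma pquot_mulE (x y : R) : 
  pquot_mul (\pi_pquot x) (\pi_pquot y) = \pi_pquot (x * y).
Proof.
unlock pquot_mul; apply/pquotP; set x' := repr _; set y' := repr _.
have -> : x' * y' - x * y = x' * (y' - y) + y * (x' - x).
  by rewrite !mulrBr addrA (mulrC y x') subrK (mulrC y).
by apply: rpredD; apply: principalM; exact: repr_pquot.
Qed.

Lemma pquot_mulA : associative pquot_mul.
Proof. by move=> x y z; rewrite -[x]reprK -[y]reprK -[z]reprK !pquot_mulE mulrA. Qed.

Lemma pquot_mulC : commutative pquot_mul.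
Proof. by move=> x y; rewrite -[x]reprK -[y]reprK !pquot_mulE mulrC. Qed.

Lemma pquot_mul1 : left_id pquot_one pquot_mul.
Proof. by move=> x; rewrite -[x]reprK pquot_mulE mul1r. Qed.

Lemma pquot_mulDl : left_distributive pquot_mul +%R.
Proof.
move=> x y z; rewrite -[x]reprK -[y]reprK -[z]reprK.
by rewrite -pi_pquotD !pquot_mulE -pi_pquotD mulrDl.
Qed.

HB.instance Definition _ := GRing.Zmodule_isComPzRing.Build pquot
  pquot_mulA pquot_mulC pquot_mul1 pquot_mulDl.

Lemma pi_pquotM (x y : R) : \pi_pquot (x * y) = \pi_pquot x * \pi_pquot y.
Proof. exact/esym/pquot_mulE. Qed.

Lemma pi_pquotB (x y : R) : \pi_pquot (x - y) = \pi_pquot x - \pi_pquot y.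
Proof. by apply/eqP; rewrite eq_sym subr_eq -pi_pquotD subrK. Qed.

End PrincipalQuotient.

Section Completion.
Variable R : idomainType.

(* The projection R/rR -> R/sR; meaningful when rR is contained in sR. *)
Definition pquot_proj (r s : R) (x : pquot r) : pquot s := \pi_(pquot s) (repr x).

Lemma pquot_projE (r s a : R) :
  r \in principal s -> pquot_proj s (\pi_(pquot r) a) = \pi_(pquot s) a.
Proof.
move=> /asboolP[b rs]; apply/pquotP.
have /asboolP[c ->] := repr_pquot r a.
by apply/asboolP; exists (b * c); rewrite rs mulrA.
Qed.

Definition pquot_prod : Type := forall r : {r : R | r != 0}, pquot (val r).
HB.instance Definition _ := Choice.on pquot_prod.

Implicit Types x y z : pquot_prod.

Let add x y : pquot_prod := fun r => x r + y r.
Let opp x : pquot_prod := fun r => - x r.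
Let mul x y : pquot_prod := fun r => x r * y r.

Let addA : associative add.
Proof. by move=> x y z; apply: functional_extensionality_dep => r; exact: addrA. Qed.
Let addC : commutative add.
Proof. by move=> x y; apply: functional_extensionality_dep => r; exact: addrC. Qed.
Let add0 : left_id (fun=> 0) add.
Proof. by move=> x; apply: functional_extensionality_dep => r; exact: add0r. Qed.
Let addN : left_inverse (fun=> 0) opp add.
Proof. by move=> x; apply: functional_extensionality_dep => r; exact: addNr. Qed.
HB.instance Definition _ := GRing.isZmodule.Build pquot_prod addA addC add0 addN.

Let mulA : associative mul.
Proof. by move=> x y z; apply: functional_extensionality_dep => r; exact: mulrA. Qed.
Let mulC : commutative mul.
Proof. by move=> x y; apply: functional_extensionality_dep => r; exact: mulrC. Qed.
Let mul1 : left_id (fun=> 1) mul.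
Proof. by move=> x; apply: functional_extensionality_dep => r; exact: mul1r. Qed.
Let mulDl : left_distributive mul +%R.
Proof. by move=> x y z; apply: functional_extensionality_dep => r; exact: mulrDl. Qed.
HB.instance Definition _ := GRing.Zmodule_isComPzRing.Build pquot_prod
  mulA mulC mul1 mulDl.

Definition compatible : pred pquot_prod := fun x =>
  `[< forall r s : {r : R | r != 0},
        val r \in principal (val s) -> pquot_proj (val s) (x r) = x s >].

Lemma compatibleP x :
  reflect (forall r s : {r : R | r != 0},
      val r \in principal (val s) -> pquot_proj (val s) (x r) = x s)
    (x \in compatible).
Proof. exact: asboolP. Qed.

Lemma pquot_proj1 (r s : R) : r \in principal s -> pquot_proj s (1 : pquot r) = 1.
Proof. exact: pquot_projE. Qed.

Lemma pquot_projB (r s : R) : r \in principal s ->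
  {morph (@pquot_proj r s) : u v / u - v}.
Proof.
move=> rs u v; rewrite -[u]reprK -[v]reprK -pi_pquotB !pquot_projE //.
exact: pi_pquotB.
Qed.

Lemma pquot_projM (r s : R) : r \in principal s ->
  {morph (@pquot_proj r s) : u v / u * v}.
Proof.
move=> rs u v; rewrite -[u]reprK -[v]reprK -pi_pquotM !pquot_projE //.
exact: pi_pquotM.
Qed.

Lemma compatible_subring_closed : subring_closed compatible.
Proof.
split=> [|x y /compatibleP xc /compatibleP yc|x y /compatibleP xc /compatibleP yc].
- by apply/compatibleP => r s rs; exact: pquot_proj1.
- by apply/compatibleP => r s rs; rewrite pquot_projB // xc // yc.
- by apply/compatibleP => r s rs; rewrite pquot_projM // xc // yc.
Qed.

Record Rcompletion := RCompletion {
  Rcompletion_val :> pquot_prod;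
  _ : compatible Rcompletion_val
}.

HB.instance Definition _ := [isSub for Rcompletion_val].
HB.instance Definition _ := [Choice of Rcompletion by <:].
HB.instance Definition _ := GRing.SubChoice_isSubComPzRing.Build
  pquot_prod compatible Rcompletion compatible_subring_closed.

End Completion.

(* Main.v *)
Require Import Defs.
From HB Require Import structures.
From mathcomp Require Import all_boot all_order all_algebra.
From mathcomp Require Import boolp classical_sets functions constructive_ereal.

(* For r <> 0 the map R -> H = Rcompletion R induces R/rR = H/rH, and r is regular
   on H. Hence H is flat over R, and, if R is not a field, faithfully flat and
   local with the same residue field k; in particular R is coherent as well.

   Over a coherent local ring A, let F be a resolution of a finitely presented
   module by finite free modules. If k (x) F is exact at F_(n+1), then F splits
   there, so that Tor_(n+1) of the presented module with every module vanishes;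
   hence wdim A <= n as soon as this happens for all F. Here exactness of k (x) F
   follows from wdim S <= n for any ring S over which A is flat, with m generated
   by elements of S: the n-th syzygy of F is then S-flat, so an element of m F_n
   lying in it lies in m times it. For A = H this is applied with S = R. For A = R
   it is applied to H (x) F, with S = H, and the result descends to R modulo m. *)

Set Implicit Arguments.
Unset Strict Implicit.
Unset Printing Implicit Defensive.

Import Order.TTheory GRing.Theory Num.Theory.

Local Open Scope ring_scope.
Local Open Scope quotient_scope.

(** * Submodules, quotients and vectors with entries in a module *)

Definition linear_pack (A : comPzRingType) (U V : lmodType A) (f : U -> V)
    (f_lin : linear f) : {linear U -> V} :=
  HB.pack f (GRing.isLinear.Build A U V *:%R f f_lin).

Section Submodules.
Variables (A : comPzRingType) (V : lmodType A).

Record submodule := Submodule {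
  smem :> V -> Prop;
  smem0 : smem 0;
  smemP : forall a x y, smem x -> smem y -> smem (a *: x + y)
}.

Variable S : submodule.

Lemma smemZ a x : S x -> S (a *: x).
Proof. by move=> Sx; rewrite -[_ *: _]addr0; exact/smemP/smem0. Qed.

Definition smemb : {pred V} := fun x => `[< S x >].

Lemma smembP x : reflect (S x) (x \in smemb).
Proof. exact: asboolP. Qed.

Lemma smemb_submod_closed : submod_closed smemb.
Proof.
split=> [|a x y /smembP Sx /smembP Sy]; apply/smembP; [exact: smem0|exact: smemP].
Qed.

HB.instance Definition _ := GRing.isSubmodClosed.Build A V smemb
  smemb_submod_closed.

Record submod := SubMod { submod_val : V; _ : smemb submod_val }.
HB.instance Definition _ := [isSub for submod_val].
HB.instance Definition _ := [Choice of submod by <:].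
HB.instance Definition _ := [SubChoice_isSubLmodule of submod by <:].

Lemma submod_valP (x : submod) : S (val x).
Proof. by case: x => x /= /asboolP. Qed.

Definition submod_in x (Sx : S x) : submod := SubMod (introT (smembP x) Sx).

Lemma submod_val_linear : linear submod_val.
Proof. exact: linearP (val : {linear submod -> V}). Qed.

HB.instance Definition _ :=
  GRing.isLinear.Build A submod V *:%R submod_val submod_val_linear.

(** [ideal_quot] uses only the additive structure, so it applies to a submodule; the scalar action
    is added afterwards. *)
Definition quomod : Type := {ideal_quot smemb}.
HB.instance Definition _ := GRing.Zmodule.on quomod.
HB.instance Definition _ := EqQuotient.on quomod.

Lemma quomodP x y : \pi_quomod x = \pi_quomod y <-> S (x - y).
Proof.
split=> xy; first by apply/smembP; exact/(eqquotP quomod).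
by apply/(eqquotP quomod); rewrite Quotient.equivE; exact/smembP.
Qed.

Lemma repr_quomod x : S (repr (\pi_quomod x) - x).
Proof. by apply/quomodP; rewrite reprK. Qed.

Lemma pi_quomodD x y : \pi_quomod (x + y) = \pi_quomod x + \pi_quomod y.
Proof. exact: Quotient.pi_add. Qed.

Definition quomod_scale a (x : quomod) : quomod := \pi_quomod (a *: repr x).

Lemma quomod_scaleE a x : quomod_scale a (\pi_quomod x) = \pi_quomod (a *: x).
Proof. by apply/quomodP; rewrite -scalerBr; apply/smemZ/repr_quomod. Qed.

Lemma quomod_scaleA a b x :
  quomod_scale a (quomod_scale b x) = quomod_scale (a * b) x.
Proof. by rewrite -[x]reprK !quomod_scaleE scalerA reprK. Qed.

Lemma quomod_scale1 : left_id 1 quomod_scale.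
Proof. by move=> x; rewrite -[x]reprK quomod_scaleE scale1r. Qed.

Lemma quomod_scaleDr : right_distributive quomod_scale +%R.
Proof.
move=> a x y; rewrite -[x]reprK -[y]reprK.
by rewrite -pi_quomodD !quomod_scaleE -pi_quomodD scalerDr.
Qed.

Lemma quomod_scaleDl x : {morph quomod_scale^~ x : a b / a + b}.
Proof. by move=> a b; rewrite -[x]reprK !quomod_scaleE -pi_quomodD scalerDl. Qed.

HB.instance Definition _ := GRing.Zmodule_isLmodule.Build A quomod
  quomod_scaleA quomod_scale1 quomod_scaleDr quomod_scaleDl.

Definition quomod_pi (x : V) : quomod := \pi_quomod x.

Lemma quomod_pi_linear : linear quomod_pi.
Proof. by move=> a x y; rewrite /quomod_pi pi_quomodD -quomod_scaleE. Qed.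

HB.instance Definition _ :=
  GRing.isLinear.Build A V quomod *:%R quomod_pi quomod_pi_linear.

Lemma quomod_pi0 x : quomod_pi x = 0 <-> S x.
Proof.
by rewrite -[0](linear0 quomod_pi) -[x in S x]subr0; exact: quomodP.
Qed.

Lemma quomod_pi_surj y : exists x, quomod_pi x = y.
Proof. by exists (repr y); rewrite /quomod_pi reprK. Qed.

End Submodules.

Section KernelImage.
Variables (A : comPzRingType) (V W : lmodType A) (f : {linear V -> W}).

Lemma ker_closed a x y : f x = 0 -> f y = 0 -> f (a *: x + y) = 0.
Proof. by move=> fx fy; rewrite linearP fx fy scaler0 addr0. Qed.

Definition ker_sub : submodule V :=
  @Submodule A V (fun x => f x = 0) (linear0 f) ker_closed.

Lemma im0 : exists x, f x = 0.
Proof. by exists 0; rewrite linear0. Qed.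

Lemma im_closed a (x y : W) : (exists z, f z = x) -> (exists z, f z = y) ->
  exists z, f z = a *: x + y.
Proof. by move=> [z <-] [t <-]; exists (a *: z + t); rewrite linearP. Qed.

Definition im_sub : submodule W :=
  @Submodule A W (fun x => exists z, f z = x) im0 im_closed.

End KernelImage.

Lemma fct_linE (A : comPzRingType) (T : Type) (M : lmodType A) a (x y : T -> M) j :
  (a *: x + y) j = a *: x j + y j.
Proof. by []. Qed.

Lemma fct_addE (M : zmodType) (T : Type) (x y : T -> M) j : (x + y) j = x j + y j.
Proof. by []. Qed.

Section Comb.
Variables (A : comPzRingType) (M : lmodType A).

(* The action x |-> x D of a matrix on row vectors with entries in M, that is,
   M (x) - applied to the map 'rV_q -> 'rV_p given by D. *)
Definition comb q p (D : 'M[A]_(q, p)) (x : 'I_q -> M) : 'I_p -> M :=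
  fun j => \sum_i D i j *: x i.

Lemma comb_linear q p (D : 'M[A]_(q, p)) : linear (comb D).
Proof.
move=> a x y; apply/funext => j; rewrite fct_linE /comb.
rewrite scaler_sumr -big_split /=.
by apply: eq_bigr => i _; rewrite fct_linE scalerDr !scalerA mulrC.
Qed.

HB.instance Definition _ q p (D : 'M[A]_(q, p)) :=
  GRing.isLinear.Build A ('I_q -> M) ('I_p -> M) *:%R (comb D) (comb_linear D).

Lemma combM r q p (E : 'M[A]_(r, q)) (D : 'M_(q, p)) x :
  comb (E *m D) x = comb D (comb E x).
Proof.
apply/funext => j; rewrite /comb.
under [RHS]eq_bigr do rewrite scaler_sumr.
rewrite exchange_big; apply: eq_bigr => i _; rewrite mxE scaler_suml.
by apply: eq_bigr => k _; rewrite scalerA mulrC.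
Qed.

Lemma comb0mx q p x : comb (0 : 'M[A]_(q, p)) x = 0.
Proof.
by apply/funext => j; rewrite /comb big1 // => i _; rewrite mxE scale0r.
Qed.

Lemma comb1mx q x : comb (1%:M : 'M[A]_q) x = x.
Proof.
apply/funext => j; rewrite /comb (bigD1 j) //= mxE eqxx scale1r big1 ?addr0 //.
by move=> i ij; rewrite mxE (negPf ij) scale0r.
Qed.

Lemma combDmx q p (D E : 'M[A]_(q, p)) x : comb (D + E) x = comb D x + comb E x.
Proof.
apply/funext => j; rewrite fctE /comb -big_split; apply: eq_bigr => i _ /=.
by rewrite mxE scalerDl.
Qed.

End Comb.

Lemma linear_comb (A : comPzRingType) (M N : lmodType A) (f : {linear M -> N})
    q p (D : 'M[A]_(q, p)) x :
  f \o comb D x = comb D (f \o x).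
Proof.
by apply/funext => j /=; rewrite linear_sum; apply: eq_bigr => i _; rewrite linearZ.
Qed.

Section Exact.
Variable A : comPzRingType.

Definition exact_mx r q p (E : 'M[A]_(r, q)) (D : 'M_(q, p)) :=
  E *m D = 0 /\ forall v : 'rV_q, v *m D = 0 -> exists w : 'rV_r, v = w *m E.

(* The equational criterion for flatness. *)
Definition eqflat (M : lmodType A) :=
  forall q (D : 'M[A]_(q, 1)) (x : 'I_q -> M), comb D x = 0 ->
  exists r (E : 'M_(r, q)) y, E *m D = 0 /\ x = comb E y.

Lemma exact_mx_lift r q p (E : 'M[A]_(r, q)) (D : 'M_(q, p)) s (F : 'M_(s, q)) :
  exact_mx E D -> F *m D = 0 -> exists W, F = W *m E.
Proof.
move=> [_ ED] FD.
have /choice[w wP] i : exists w, row i F = w *m E.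
  by apply: ED; rewrite -row_mul FD row0.
by exists (\matrix_i w i); apply/row_matrixP => i; rewrite row_mul rowK.
Qed.

End Exact.

(** * Flatness and linear relations *)

Section FlatToEquational.
Variables (A : comPzRingType) (M : lmodType A) (q p : nat) (D : 'M[A]_(q, p)).
Hypothesis flatM : flat M.

Let K := ker_sub (mulmxr D : {linear 'rV[A]_q -> 'rV_p}).
Let N := quomod K.

Let f (v : N) : 'rV[A]_p := repr v *m D.

Let f_pi (v : 'rV_q) : f (quomod_pi K v) = v *m D.
Proof.
by apply/eqP; rewrite -subr_eq0 -mulmxBl; apply/eqP; exact: (repr_quomod K v).
Qed.

Let f_linear : linear f.
Proof.
move=> a x y; have [v <-] := quomod_pi_surj x; have [w <-] := quomod_pi_surj y.
by rewrite -linearP !f_pi mulmxDl scalemxAl.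
Qed.

HB.instance Definition _ := GRing.isLinear.Build A N 'rV[A]_p *:%R f f_linear.

Let f_inj : injective f.
Proof.
move=> x y; have [v <-] := quomod_pi_surj x; have [w <-] := quomod_pi_surj y.
rewrite !f_pi => vw; apply/quomodP; rewrite /= mulmxBl vw subrr //.
Qed.

Let syz (x : 'I_q -> M) :=
  exists r (E : 'M_(r, q)) y, E *m D = 0 /\ x = comb E y.

Let syz0 : syz 0.
Proof. by exists 0%N, 0, 0; rewrite mul0mx linear0. Qed.

Let syz_closed a x y : syz x -> syz y -> syz (a *: x + y).
Proof.
move=> [r [E [u [ED ->]]]] [s [F [v [FD ->]]]].
exists (r + s)%N, (col_mx (a *: E) F),
  (fun i => match fintype.split i with inl i => u i | inr i => v i end).
split; first by rewrite mul_col_mx -scalemxAl ED FD scaler0 col_mx0.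
apply/funext => j; rewrite fct_linE /comb big_split_ord /= scaler_sumr.
congr (_ + _); apply: eq_bigr => i _.
  by rewrite col_mxEu mxE (unsplitK (inl i)) scalerA.
by rewrite col_mxEd (unsplitK (inr i)).
Qed.

Let S : submodule ('I_q -> M) := Submodule syz0 syz_closed.
Let T := quomod S.

Let outer (m : M) (v : 'rV[A]_q) : 'I_q -> M := fun k => v 0 k *: m.

Let outerE m v : outer m v = comb v (fun=> m).
Proof. by apply/funext => k; rewrite /comb big_ord1. Qed.

Let b (m : M) (n : N) : T := quomod_pi S (outer m (repr n)).

(** Two representatives differ by some w with w D = 0, and [outer m w] is a syzygy whose matrix has
    the single row w. *)
Let b_pi m v : b m (quomod_pi K v) = quomod_pi S (outer m v).
Proof.
apply/quomodP; exists 1%N, (repr (quomod_pi K v) - v), (fun=> m).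
split; first exact: (repr_quomod K v).
by rewrite -outerE; apply/funext => k; rewrite /outer !fctE !mxE scalerBl.
Qed.

Let b_bilin : bilinear_map b.
Proof.
split=> [n|m] a u v.
  rewrite -linearP; congr quomod_pi; apply/funext => k.
  by rewrite /outer fct_linE scalerDr !scalerA mulrC.
have [u' <-] := quomod_pi_surj u; have [v' <-] := quomod_pi_surj v.
rewrite -linearP !b_pi -linearP; congr quomod_pi; apply/funext => k.
by rewrite /outer fct_linE !mxE scalerDl scalerA.
Qed.

(** The quotient [N] of A^q by the kernel of [D] embeds into A^p. The sum [t] of the tensors of
    [x k] with the class of e_k dies in the tensor product of M with A^p because [comb D x = 0], so
    [t = 0] by flatness. The bilinear map [b] sends [t] to the class of [x] modulo [syz], which is
    therefore zero. *)
Lemma flat_comb (x : 'I_q -> M) : comb D x = 0 ->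
  exists r (E : 'M_(r, q)) y, E *m D = 0 /\ x = comb E y.
Proof.
move=> Dx; pose e k : 'rV[A]_q := delta_mx 0 k.
pose t : tensor M N := \sum_k tens (x k) (quomod_pi K (e k)).
have t0 : t = 0.
  apply: (flatM f_inj); rewrite linear0 linear_sum.
  have [linl linr] := tens_bilinear M ('rV[A]_p : lmodType A).
  pose Lr m := linear_pack (linr m); pose Ll n := linear_pack (linl n).
  (* Expanding row k of [D] in the standard basis makes the coefficient of e_j equal to
     [comb D x j]. *)
  transitivity (\sum_k \sum_j Ll (delta_mx 0 j) (D k j *: x k)).
    apply: eq_bigr => k _; rewrite [LHS]tensor_map_tens.
    rewrite [X in tens _ X]f_pi -rowE.
    rewrite [row k D]row_sum_delta.
    rewrite -[LHS]/(Lr (x k) _) linear_sum; apply: eq_bigr => j _.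
    by rewrite linearZ [RHS]linearZZ mxE.
  rewrite exchange_big big1 // => j _; rewrite -linear_sum.
  by rewrite [X in Ll _ X](congr1 (@^~ j) Dx) linear0.
pose L := linear_pack (tensor_lift_linear b_bilin).
have : L t = 0 by rewrite t0 linear0.
rewrite linear_sum.
under eq_bigr do rewrite [L _](tensor_lift_tens b_bilin) b_pi.
rewrite -linear_sum => /quomod_pi0; suff -> : \sum_k outer (x k) (e k) = x by [].
apply/funext => j; rewrite fct_sumE (bigD1 j) //= /outer mxE !eqxx scale1r.
rewrite big1 ?addr0 // => k kj; rewrite mxE eqxx /= eq_sym (negPf kj).
by rewrite scale0r.
Qed.

End FlatToEquational.

Section EquationalToFlat.
Variables (A : comPzRingType) (M : lmodType A).

(* [represents s y c] : the formal sum s of M (x) P is rewritten as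
   \sum_j y j (x) c j using bilinearity only. *)
Fixpoint represents (P : lmodType A) (s : seq (M * P)) k (y : 'I_k -> M)
    (c : 'I_k -> P) : Prop :=
  if s is (m, p) :: s' then
    exists (a : 'rV[A]_k) (c' : 'I_k -> P),
      [/\ m = \sum_j a 0 j *: y j, represents s' y c'
        & c = fun j => a 0 j *: p + c' j]
  else c = fun=> 0.

Section Fixed.
Variable P : lmodType A.
Implicit Types (s t u : seq (M * P)).

(** The scalars of [E] are moved across the tensor sign, from the [M] side to the [P] side. *)
Lemma represents_comb s k l (E : 'M[A]_(k, l)) (w : 'I_k -> M) c :
  represents s (comb E w) c -> represents s w (fun i => \sum_j E i j *: c j).
Proof.
elim: s c => [|[m p] s IH] c /=.
  by move=> ->; apply/funext => i; rewrite big1 // => j _; rewrite scaler0.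
move=> [a [c' [-> sc' ->]]].
exists (\row_i \sum_j E i j * a 0 j), (fun i => \sum_j E i j *: c' j).
split; last 1 first.
- apply/funext => i; rewrite mxE scaler_suml -big_split; apply: eq_bigr => j _ /=.
  by rewrite scalerDr scalerA.
- rewrite /comb; under eq_bigr do rewrite scaler_sumr.
  rewrite exchange_big; apply: eq_bigr => i _; rewrite mxE scaler_suml.
  by apply: eq_bigr => j _; rewrite scalerA mulrC.
- exact: IH.
Qed.

Lemma represents_cat s t k (y : 'I_k -> M) c d :
  represents s y c -> represents t y d ->
  represents (s ++ t) y (fun j => c j + d j).
Proof.
elim: s c => [|[m p] s IH] c /=.
  by move=> -> td; suff -> : (fun j => 0 + d j) = d by []; apply/funext => j;
    rewrite add0r.
move=> [a [c' [-> sc' ->]]] td; exists a, (fun j => c' j + d j); split=> //.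
  exact: IH.
by apply/funext => j; rewrite addrA.
Qed.

Lemma represents_catP s t k (y : 'I_k -> M) e :
  represents (s ++ t) y e -> exists c d,
  [/\ represents s y c, represents t y d & e = fun j => c j + d j].
Proof.
elim: s e => [|[m p] s IH] e /=.
  by move=> te; exists (fun=> 0), e; split=> //; apply/funext => j; rewrite add0r.
move=> [a [e' [-> /IH[c [d [sc td ->]]] ->]]].
exists (fun j => a 0 j *: p + c j), d; split=> //; first by exists a, c.
by apply/funext => j; rewrite addrA.
Qed.

Lemma represents_sum s k (y : 'I_k -> M) c :
  represents s y c ->
  \sum_(x <- s) tens x.1 x.2 = \sum_j tens (y j) (c j) :> tensor M P.
Proof.
have [linl linr] := tens_bilinear M P.
elim: s c => [|[m p] s IH] c /=.
  move=> ->; rewrite big_nil big1 // => j _.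
  exact: (linear0 (linear_pack (linr (y j)))).
move=> [a [c' [-> /IH sc ->]]]; rewrite big_cons sc /=.
rewrite -[tens _ p]/(linear_pack (linl p) _) linear_sum -big_split.
apply: eq_bigr => j _ /=; rewrite linr; congr (_ + _).
by rewrite -[LHS]/(linear_pack (linl p) _) linearZZ.
Qed.

(** One common rewriting replaces the chain of intermediate sums in [tensor_eq]. Its coefficients
    [c] are combinations of second components of [s], hence stay inside any submodule of [P]
    containing those. *)
Definition same_sum s t := exists k (y : 'I_k -> M) c,
  represents s y c /\ represents t y c.

Hypothesis flatM : eqflat M.

(* Flatness of M makes any two expressions of the coefficients of s comparable,
   which is what transitivity of [same_sum] requires. *)
Lemma represents_common s k l (y : 'I_k -> M) (z : 'I_l -> M) c d :
  represents s y c -> represents s z d ->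
  exists r (w : 'I_r -> M) (E : 'M[A]_(r, k)) (F : 'M[A]_(r, l)),
  [/\ y = comb E w, z = comb F w
    & forall i, \sum_j E i j *: c j = \sum_j F i j *: d j].
Proof.
elim: s c d => [|[m p] s IH] c d /=.
  (* For the empty sum, [w] is the concatenation of [y] and [z], and all coefficients vanish. *)
  move=> -> ->; exists (k + l)%N, (fun i => match fintype.split i with
    inl i => y i | inr i => z i end), (col_mx 1%:M 0), (col_mx 0 1%:M).
  split; last by move=> i; rewrite !big1 // => j _; rewrite scaler0.
    rewrite -[LHS]comb1mx; apply/funext => j; rewrite /comb big_split_ord /=.
    rewrite [X in _ + X]big1 ?addr0 => [|i _]; last by rewrite col_mxEd mxE scale0r.
    by apply: eq_bigr => i _; rewrite col_mxEu (unsplitK (inl i)).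
  rewrite -[LHS]comb1mx; apply/funext => j; rewrite /comb big_split_ord /=.
  rewrite [X in X + _]big1 ?add0r => [|i _]; last by rewrite col_mxEu mxE scale0r.
  by apply: eq_bigr => i _; rewrite col_mxEd (unsplitK (inr i)).
move=> [a [c' [ma sc' ->]]] [b [d' [mb sd' ->]]].
have [r [w [E [F [yE zF EF]]]]] := IH _ _ sc' sd'.
(* The two expressions of [m] give a linear relation on [w]. The equational criterion refines [w] to
   [w'], over which the coefficients of [p] also agree. *)
have rel0 : comb (E *m a^T - F *m b^T) w = 0.
  rewrite -[_ - _]/(E *m a^T + - (F *m b^T)) combDmx -mulmxN !combM -yE -zF.
  apply/funext => j; rewrite ord1 fct_addE /comb.
  under eq_bigr do rewrite mxE; under [X in _ + X]eq_bigr do rewrite !mxE scaleNr.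
  by rewrite sumrN -ma -mb subrr.
have [r' [G [w' [G0 wG]]]] := flatM rel0.
exists r', w', (G *m E), (G *m F).
split; [by rewrite yE wG combM | by rewrite zF wG combM |].
have coef n (H : 'M[A]_(r, n)) (f : 'I_n -> P) (u : 'rV_n) i :
    \sum_j (G *m H) i j *: (u 0 j *: p + f j) =
    (G *m (H *m u^T)) i 0 *: p + \sum_l G i l *: \sum_j H l j *: f j.
  under eq_bigr do rewrite scalerDr.
  rewrite big_split /=; congr (_ + _).
    rewrite mulmxA mxE scaler_suml; apply: eq_bigr => j _.
    by rewrite scalerA [u^T _ _]mxE.
  under [RHS]eq_bigr do rewrite scaler_sumr.
  rewrite exchange_big; apply: eq_bigr => j _; rewrite mxE scaler_suml.
  by apply: eq_bigr => n' _; rewrite scalerA.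
move=> i; rewrite !coef; congr (_ *: _ + _); last first.
  by apply: eq_bigr => l' _; rewrite EF.
by apply/eqP; rewrite -subr_eq0; move: G0; rewrite mulmxBr =>
  /matrixP/(_ i 0); rewrite !mxE => ->.
Qed.

Lemma same_sum_trans s t u : same_sum s t -> same_sum t u -> same_sum s u.
Proof.
move=> [k [y [c [sc tc]]]] [l [z [d [td ud]]]].
have [r [w [E [F [yE zF EF]]]]] := represents_common tc td.
exists r, w, (fun i => \sum_j E i j *: c j); split.
  by apply: represents_comb; rewrite -yE.
rewrite (_ : (fun i => _) = fun i => \sum_j F i j *: d j); last exact/funext.
by apply: represents_comb; rewrite -zF.
Qed.

Lemma same_sum_cat s s' t t' :
  same_sum s s' -> same_sum t t' -> same_sum (s ++ t) (s' ++ t').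
Proof.
move=> [k [y [c [sc s'c]]]] [l [z [d [td t'd]]]].
(* The empty sum is represented over both [y] and [z], which yields a family [w] generating both. *)
have [r [w [E [F [yE zF _]]]]] :=
  @represents_common [::] k l y z _ _ erefl erefl.
rewrite {}yE in sc s'c; rewrite {}zF in td t'd.
exists r, w, (fun i => \sum_j E i j *: c j + \sum_j F i j *: d j).
by split; apply: represents_cat; exact: represents_comb.
Qed.

Lemma same_sum_refl s : same_sum s s.
Proof.
elim: s => [|[m p] s IH]; first by exists 0%N, (fun=> 0), (fun=> 0).
rewrite -cat1s; apply: same_sum_cat IH; exists 1%N, (fun=> m), (fun=> p).
suff h : represents [:: (m, p)] (fun _ : 'I_1 => m) (fun=> p) by [].
exists (const_mx 1), (fun=> 0); split=> //.
  by rewrite big_ord1 mxE scale1r.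
by apply/funext => j; rewrite mxE scale1r addr0.
Qed.

Lemma tensor_eq_same_sum s t : tensor_eq s t -> same_sum s t.
Proof.
elim=> {s t}.
- exact: same_sum_refl.
- by move=> s t _ [k [y [c [sc tc]]]]; exists k, y, c.
- by move=> s t u _ + _; exact: same_sum_trans.
- by move=> s s' t t' _ + _; exact: same_sum_cat.
- move=> s t; have [k [y [e [ste _]]]] := same_sum_refl (s ++ t).
  exists k, y, e; split=> //; have [c [d [sc td ->]]] := represents_catP ste.
  rewrite (_ : (fun j => _) = fun j => d j + c j); first exact: represents_cat.
  by apply/funext => j; rewrite addrC.
- move=> p; exists 0%N, (fun=> 0), (fun=> 0); split=> //.
  exists 0, (fun=> 0); split=> //; first by rewrite big_ord0.
  by apply/funext => -[].
- move=> m m' p; have [k [y [c [mc _]]]] := same_sum_refl [:: (m, p); (m', p)].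
  exists k, y, c; split=> //; case: mc => a [_ [-> [b [_ [-> -> ->]] ->]]].
  exists (a + b), (fun=> 0); split=> //.
    by rewrite -big_split; apply: eq_bigr => j _; rewrite mxE scalerDl.
  by apply/funext => j; rewrite mxE scalerDl !addr0.
- move=> m p p'; exists 1%N, (fun=> m), (fun=> p + p').
  have one : m = \sum_(j < 1) (const_mx 1 : 'rV[A]_1) 0 j *: m.
    by rewrite big_ord1 mxE scale1r.
  split; exists (const_mx 1).
    by exists (fun=> 0); split=> //; apply/funext => j; rewrite mxE scale1r addr0.
  exists (fun=> p'); split=> //; last by apply/funext => j; rewrite mxE scale1r.
  exists (const_mx 1), (fun=> 0); split=> //.
  by apply/funext => j; rewrite mxE scale1r addr0.
- move=> a m p; exists 1%N, (fun=> m), (fun=> a *: p); split.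
    exists (const_mx a), (fun=> 0); split=> //; first by rewrite big_ord1 mxE.
    by apply/funext => j; rewrite mxE addr0.
  exists (const_mx 1), (fun=> 0); split=> //; first by rewrite big_ord1 mxE scale1r.
  by apply/funext => j; rewrite mxE scale1r addr0.
Qed.

End Fixed.

(** Each coefficient is a linear combination of the values [f x.2], so it lifts along [f]. *)
Lemma represents_inj (N P : lmodType A) (f : {linear N -> P})
    (s : seq (M * N)) k (y : 'I_k -> M) c :
  represents [seq (x.1, f x.2) | x <- s] y c ->
  exists2 d, represents s y d & c = f \o d.
Proof.
elim: s c => [|[m n] s IH] c /=.
  by move=> ->; exists (fun=> 0) => //; apply/funext => j /=; rewrite linear0.
move=> [a [c' [-> /IH[d sd ->] ->]]].
exists (fun j => a 0 j *: n + d j); first by exists a, d.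
by apply/funext => j /=; rewrite linearP.
Qed.

(** If the image of a formal sum vanishes, it shares a rewriting with the empty sum, so its
    coefficients are zero. These coefficients lift to [N], where injectivity of [f] makes them zero
    too. *)
Lemma eqflat_flat : eqflat M -> flat M.
Proof.
move=> flatM N P f f_inj; apply: raddf_inj => x fx.
move: fx; rewrite -[x]reprK; move: (repr x) => s {x}.
rewrite tensor_sum => fx.
have : \pi_(tensor M P) [seq (x.1, f x.2) | x <- s] = \pi_(tensor M P) [::].
  rewrite !tensor_sum big_nil big_map; move: fx.
  pose F : {linear tensor M N -> tensor M P} := tensor_map f.
  rewrite -[LHS]/(F _) linear_sum => fx; rewrite -[RHS]fx.
  by apply: eq_bigr => -[m n] _; rewrite [RHS]tensor_map_tens.
move/eqtensP/(tensor_eq_same_sum flatM) => [k [y [c [sc /= c0]]]].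
have [d sd cd] := represents_inj sc; rewrite (represents_sum sd) big1 // => j _.
have -> : d j = 0.
  by apply: f_inj; rewrite linear0; move: cd; rewrite c0 => /(congr1 (@^~ j)) /= <-.
have [linl linr] := tens_bilinear M N.
exact: (linear0 (linear_pack (linr (y j)))).
Qed.

End EquationalToFlat.

(** * Chains of matrices and vanishing of Tor *)

Section Chains.
Variable A : comPzRingType.

(** A resolution of the cokernel of [chain_mx 0] by finite free modules, matrices acting on row
    vectors from the right. *)
Record chain := Chain {
  rk : nat -> nat;
  chain_mx : forall i, 'M[A]_(rk i.+1, rk i);
  chain_exact : forall i, exact_mx (chain_mx i.+1) (chain_mx i)
}.

(** Coherence in matrix form: kernels of maps between finite free modules are finitely generated. *)
Definition mxcoherent := forall q p (D : 'M[A]_(q, p)),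
  exists r (E : 'M_(r, q)), exact_mx E D.

Definition mxflat (M : lmodType A) :=
  forall r q p (E : 'M[A]_(r, q)) (D : 'M_(q, p)), exact_mx E D ->
  forall x : 'I_q -> M, comb D x = 0 -> exists y, x = comb E y.

(* Tor_(n+1) of S vanishes on the modules presented by exact chains. *)
Definition tor_zero n (V : lmodType A) (S : V -> Prop) :=
  forall (c : chain) (x : 'I_(rk c n.+1) -> V), (forall k, S (x k)) ->
  comb (chain_mx c n) x = 0 ->
  exists2 y : 'I_(rk c n.+2) -> V,
    (forall k, S (y k)) & x = comb (chain_mx c n.+1) y.

Lemma flat_mxflat (M : lmodType A) : flat M -> mxflat M.
Proof.
move=> flatM r q p E D ED x Dx.
have [r' [E' [y [E'D ->]]]] := flat_comb flatM Dx.
have [W ->] := exact_mx_lift ED E'D.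
by exists (comb W y); rewrite combM.
Qed.

Lemma mxflat_eqflat (M : lmodType A) : mxcoherent -> mxflat M -> eqflat M.
Proof.
move=> coh flatM q D x Dx; have [r [E ED]] := coh _ _ D.
by have [y ->] := flatM _ _ _ _ _ ED _ Dx; exists r, E, y; split=> //; case: ED.
Qed.

Section Shift.
Variables (F P : lmodType A) (f : {linear F -> P}).
Hypothesis flatF : mxflat F.

Let lift_im k (x : 'I_k -> P) : (forall i, exists z, f z = x i) ->
  exists y, x = f \o y.
Proof. by move=> /choice[y fy]; exists y; apply/funext => i; rewrite /= fy. Qed.

(** Dimension shifting along 0 -> ker f -> F -> im f -> 0. A cycle in the image is lifted to [z];
    the boundary of [z] is a cycle in the kernel, hence the boundary of some [w] there, and flatness
    of [F] makes the cycle [z - w] a boundary. *)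
Lemma tor_zero_im n :
  tor_zero n (fun x => f x = 0) -> tor_zero n.+1 (fun x => exists z, f z = x).
Proof.
move=> Tn c x /lift_im[z ->] Dx.
have kerD k : f (comb (chain_mx c n.+1) z k) = 0.
  by rewrite -[LHS]/((f \o comb _ z) k) linear_comb Dx.
have DD i : chain_mx c i.+1 *m chain_mx c i = 0 by case: (chain_exact c i).
have [|w fw Dw] := Tn c (comb (chain_mx c n.+1) z) kerD;
  first by rewrite -combM DD comb0mx.
have [|t zw] := flatF (chain_exact c n.+1) (x := z - w).
  by rewrite linearB /= Dw subrr.
exists (f \o t) => [k|]; first by exists (t k).
rewrite -linear_comb -zw; apply/funext => k /=.
by rewrite -[(z - w) k]/(z k - w k) linearB fw subr0.
Qed.

(** The shift in the other direction: a cycle in the kernel bounds some [y] in [F], and [f \o y] is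
    a cycle in the image. Subtracting from [y] a boundary with the same image moves it into the
    kernel. *)
Lemma tor_zero_ker n :
  tor_zero n.+1 (fun x => exists z, f z = x) -> tor_zero n (fun x => f x = 0).
Proof.
move=> Tn c x fx Dx; have [y xy] := flatF (chain_exact c n) Dx.
have [||_ /lift_im[t ->] yt] := Tn c (f \o y) => [k||]; first by exists (y k).
  by rewrite -linear_comb -xy; apply/funext => k /=; rewrite fx.
exists (y - comb (chain_mx c n.+2) t) => [k|].
  move/(congr1 (@^~ k)): yt; rewrite -linear_comb /= => fyk.
  by rewrite -[(y - _) k]/(y k - comb _ t k) linearB fyk subrr.
rewrite linearB /= -combM; case: (chain_exact c n.+1) => -> _.
by rewrite comb0mx subr0.
Qed.

End Shift.

Lemma tor_zero_resolution n (F : nat -> lmodType A)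
    (d : forall i, {linear F i.+1 -> F i}) (P : lmodType A)
    (f : {linear F 0 -> P}) :
  (forall i, mxflat (F i)) -> (forall i, (n < i)%N -> forall x : F i, x = 0) ->
  (forall y, f y = 0 <-> exists z, d 0 z = y) ->
  (forall i (y : F i.+1), d i y = 0 <-> exists z, d i.+1 z = y) ->
  tor_zero n (fun x => exists z, f z = x).
Proof.
elim: n F d P f => [|n IH] F d P f flatF F0 kerf kerd.
  move=> c x /choice[z xz] Dx.
  have {}xz : x = f \o z by apply/funext => k /=; rewrite xz.
  (* Since [F 1 = 0], the map [f] is injective and its image is a copy of the flat module [F 0]. *)
  have [|y zy] := flatF 0 _ _ _ _ _ (chain_exact c 0) z.
    apply/funext => k; move: Dx; rewrite xz -linear_comb => /(congr1 (@^~ k)) /=.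
    by move=> /kerf[t <-]; rewrite (F0 1%N _ t) // linear0.
  exists (f \o y) => [k|]; first by exists (y k).
  by rewrite xz zy linear_comb.
apply: tor_zero_im; first exact: flatF.
rewrite (_ : (fun x => _) = fun x => exists z, d 0 z = x).
  by apply: (IH (fun i => F i.+1) (fun i => d i.+1)) => // i ni; exact: F0.
by apply/funext => x; apply/propext.
Qed.

Lemma has_flat_resolution_tor_zero (M : lmodType A) n :
  has_flat_resolution M n -> tor_zero n (fun _ : M => True).
Proof.
move=> [F [d [e [flatF F0 e_surj kere kerd]]]].
rewrite (_ : (fun _ => True) = fun x => exists z, e z = x).
  by apply: tor_zero_resolution kere kerd => // i; exact/flat_mxflat/flatF.
by apply/funext => x; apply/propext; split.
Qed.

Section ChainOf.
Hypothesis coh : mxcoherent.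

(** Bundling the sizes turns the choice of a syzygy matrix into a self-map, which can be
    iterated. *)
Record some_mx := SomeMx { nrow : nat; ncol : nat; smx : 'M[A]_(nrow, ncol) }.

Definition next_mx (s : some_mx) : some_mx :=
  let r := cid (coh (smx s)) in let E := cid (projT2 r) in SomeMx (projT1 E).

Lemma next_mx_exact s : exact_mx (smx (next_mx s)) (smx s).
Proof. exact: projT2 (cid (projT2 (cid (coh (smx s))))). Qed.

Definition chain_of q p (D : 'M[A]_(q, p)) : chain :=
  @Chain (fun i => ncol (iter i next_mx (SomeMx D)))
    (fun i => smx (iter i next_mx (SomeMx D)))
    (fun i => next_mx_exact (iter i next_mx (SomeMx D))).

(** Vanishing of Tor_1, tested on the chain starting with [D], is the equational criterion with
    solutions kept in [S]. *)
Lemma tor_zero_mx (V : lmodType A) (S : V -> Prop) q p (D : 'M[A]_(q, p))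
    (x : 'I_q -> V) :
  tor_zero 0 S -> (forall k, S (x k)) -> comb D x = 0 ->
  exists r (E : 'M_(r, q)) (y : 'I_r -> V),
    [/\ E *m D = 0, forall k, S (y k) & x = comb E y].
Proof.
move=> T0 Sx Dx; have [y Sy xy] := T0 (chain_of D) x Sx Dx.
exists (rk (chain_of D) 2), (chain_mx (chain_of D) 1), y; split=> //.
exact: (chain_exact (chain_of D) 0).1.
Qed.

Lemma tor_zero_flat (M : lmodType A) : tor_zero 0 (fun _ : M => True) -> flat M.
Proof.
move=> T0; apply: eqflat_flat => q D x Dx.
have [r [E [y [ED _ xy]]]] := tor_zero_mx T0 (fun=> I) Dx.
by exists r, E, y.
Qed.

(* In an exact sequence of flat modules with Tor_(n+1)(im f) = 0, the image of
   d n is a flat syzygy, so I F_n meets it in I (im d n). *)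
Lemma syzygy_pure n (F : nat -> lmodType A)
    (d : forall i, {linear F i.+1 -> F i}) (P : lmodType A)
    (f : {linear F 0 -> P}) :
  (forall i, mxflat (F i)) ->
  (forall y, f y = 0 <-> exists z, d 0 z = y) ->
  (forall i (y : F i.+1), d i y = 0 <-> exists z, d i.+1 z = y) ->
  tor_zero n (fun x => exists z, f z = x) ->
  forall q (a : 'I_q -> A) (u : 'I_q -> F n) (v : F n.+1),
  d n v = \sum_k a k *: u k ->
  exists (x : 'I_q -> F n.+1) w, v = \sum_k a k *: x k + d n.+1 w.
Proof.
elim: n F d P f => [|n IH] F d P f flatF kerf kerd Tn; last first.
  (* Dropping [F 0] replaces the image of [f] by its kernel, the image of [d 0], and lowers the Tor
     index by one. *)
  apply: (IH (fun i => F i.+1) (fun i => d i.+1) _ (d 0)) => //.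
  rewrite (_ : (fun x => _) = fun x => f x = 0).
    exact: tor_zero_ker.
  by apply/funext => x; apply/propext; split=> /kerf.
move=> q a u v dv.
(* Applying [f] to the right-hand side gives zero, so the [a k] are coefficients of a relation
   between the [f (u k)] in the flat module im f. *)
have [||r [E [y [Ea /choice[g fg] uE]]]] :=
  tor_zero_mx (D := \col_k a k) (x := f \o u) Tn.
- by move=> k; exists (u k).
- apply/funext => j; rewrite -linear_comb /= /comb.
  under eq_bigr do rewrite mxE; rewrite -dv; apply/kerf.
  by exists v.
have {}fg : y = f \o g by apply/funext => k /=; rewrite fg.
have /choice[x dx] k : exists x, d 0 x = u k - comb E g k.
  apply/kerf; rewrite linearB -[f (u k)]/((f \o u) k) uE fg.
  by rewrite -[f (comb _ _ _)]/((f \o comb E g) k) linear_comb subrr.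
(* What [d 0] leaves of the difference is the combination of the [comb E g k] with coefficients
   [a k], zero because [E] annihilates the column [a]. *)
exists x; have [w dw] : exists w, d 1 w = v - \sum_k a k *: x k.
  apply/kerd; rewrite linearB dv linear_sum.
  under [X in _ - X]eq_bigr do rewrite linearZ_LR dx scalerBr.
  rewrite big_split /= opprD addrA subrr sub0r sumrN opprK.
  have := congr1 (fun D => comb D g (0 : 'I_1)) Ea; rewrite comb0mx combM /comb.
  by under eq_bigr do rewrite mxE.
by exists w; rewrite dw addrC subrK.
Qed.

End ChainOf.

End Chains.

(** * Flat resolutions *)

Section FreeCover.
Variables (A : comPzRingType) (M : lmodType A).

Definition finsupp (f : M -> A^o) := exists s : seq M, forall x, x \notin s -> f x = 0.

Lemma finsupp0 : finsupp 0.
Proof. by exists [::]. Qed.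

Lemma finsupp_closed a f g : finsupp f -> finsupp g -> finsupp (a *: f + g).
Proof.
move=> [s fs] [t gt]; exists (s ++ t) => x; rewrite mem_cat negb_or => /andP[xs xt].
by rewrite fct_linE fs // gt // scaler0 addr0.
Qed.

Definition free_on := submod (Submodule finsupp0 finsupp_closed).

Let supp (f : free_on) : seq M := undup (projT1 (cid (submod_valP f))).

Let suppP f x : x \notin supp f -> val f x = 0.
Proof. by rewrite mem_undup; case: cid => s /= /(_ x). Qed.

Let val_lin a (f g : free_on) x : val (a *: f + g) x = a * val f x + val g x.
Proof. exact: (congr1 (fun h : M -> A^o => h x) (submod_val_linear a f g)). Qed.

Let ev_lin (m : M) : linear (fun f : free_on => val f m : A^o).
Proof. by move=> a f g; exact: val_lin. Qed.

Let ev m := linear_pack (ev_lin m).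

Definition free_eval (f : free_on) : M := \sum_(x <- supp f) val f x *: x.

(** The support list is an arbitrary choice; any duplicate-free list containing the support gives
    the same sum, so several elements can be evaluated over one list. *)
Lemma free_evalE f (s : seq M) : uniq s -> (forall x, x \notin s -> val f x = 0) ->
  free_eval f = \sum_(x <- s) val f x *: x.
Proof.
move=> s_uniq fs.
have nz (t : seq M) : \sum_(x <- t) val f x *: x =
    \sum_(x <- [seq x <- t | val f x != 0]) val f x *: x.
  rewrite big_filter [RHS]big_mkcond; apply: eq_bigr => x _.
  by case: eqP => //= ->; rewrite scale0r.
rewrite /free_eval (nz (supp f)) (nz s); apply: perm_big; apply: uniq_perm.
- exact/filter_uniq/undup_uniq.
- exact: filter_uniq.
- move=> x; rewrite !mem_filter; case: eqP => //= fx.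
  by transitivity true; [|apply/esym]; apply/negPn/negP => /[dup];
    [move/suppP|move/fs].
Qed.

Lemma free_eval_linear : linear free_eval.
Proof.
move=> a f g; set s := undup (supp f ++ supp g).
have s_uniq : uniq s by exact: undup_uniq.
have fs x : x \notin s -> val f x = 0.
  by rewrite mem_undup mem_cat negb_or => /andP[/suppP].
have gs x : x \notin s -> val g x = 0.
  by rewrite mem_undup mem_cat negb_or => /andP[_ /suppP].
rewrite (free_evalE s_uniq fs) (free_evalE s_uniq gs) (@free_evalE _ s) //.
  rewrite scaler_sumr -big_split; apply: eq_bigr => x _.
  by rewrite val_lin scalerDl -scalerA.
by move=> x xs; rewrite val_lin fs // gs // mulr0 addr0.
Qed.

HB.instance Definition _ :=
  GRing.isLinear.Build A free_on M *:%R free_eval free_eval_linear.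

Lemma free_eval_surj x : exists f, free_eval f = x.
Proof.
pose g y : A^o := if y == x then 1 else 0.
have gs : finsupp g by exists [:: x] => y; rewrite inE /g => /negPf ->.
exists (submod_in (S := Submodule finsupp0 finsupp_closed) gs).
rewrite (@free_evalE _ [:: x]) //= ?big_seq1 /= /g ?eqxx ?scale1r // => y.
by rewrite inE => /negPf ->.
Qed.

Lemma free_mxflat : mxflat free_on.
Proof.
move=> r q p E D [_ ED] x Dx.
have coeff m : (\row_k val (x k) m) *m D = 0.
  apply/rowP => j; rewrite !mxE; have := congr1 (@^~ j) (linear_comb (ev m) D x).
  rewrite Dx /= => Dxm; rewrite -[RHS](linear0 (ev m)) [RHS]Dxm.
  by apply: eq_bigr => k _; rewrite mxE mulrC.
(* The equation is solved separately at each basis element. Choosing the solution 0 for the vector 0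
   keeps the assembled functions finitely supported. *)
have /choice[w wP] (v : 'rV[A]_q) : exists w : 'rV_r,
    (v = 0 -> w = 0) /\ (v *m D = 0 -> v = w *m E).
  have [->|v0] := eqVneq v 0; first by exists 0; rewrite mul0mx.
  have [/ED[w vw]|vD] := pselect (v *m D = 0); last by exists 0.
  by exists w; split=> // v0'; rewrite v0' eqxx in v0.
pose s := flatten [seq supp (x k) | k : 'I_q].
have y_supp j : finsupp (fun m => w (\row_k val (x k) m) 0 j).
  exists s => m ms; rewrite (wP _).1 ?mxE //; apply/rowP => k; rewrite !mxE.
  apply: suppP; apply: contra ms => mk; apply/flatten_mapP; exists k => //.
  by rewrite mem_enum.
exists (fun j => submod_in (S := Submodule finsupp0 finsupp_closed) (y_supp j)).
apply/funext => k; apply: val_inj; apply/funext => m.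
rewrite -[RHS]/((ev m \o comb E _) k) linear_comb /comb.
have := (wP (\row_k val (x k) m)).2 (coeff m).
move=> /rowP/(_ k); rewrite !mxE => ->; apply: eq_bigr => j _.
by rewrite mulrC.
Qed.

End FreeCover.

Section Resolutions.
Variable A : comPzRingType.
Hypothesis coh : mxcoherent A.

Lemma zero_flat : flat ('rV[A]_0 : lmodType A).
Proof.
apply: eqflat_flat => q D x _; exists 0%N, 0, (fun=> 0).
by rewrite mul0mx; split=> //; apply/funext => k; rewrite (thinmx0 (x k)) [RHS]thinmx0.
Qed.

Lemma flat_has_flat_resolution (M : lmodType A) : flat M -> has_flat_resolution M 0.
Proof.
move=> flatM; pose Z : lmodType A := 'rV[A]_0.
pose F i : lmodType A := if i is 0%N then M else Z.
exists F, (fun i => \0 : {linear F i.+1 -> F i}), idfun.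
have Z0 (x y : Z) : x = y by rewrite (thinmx0 x) (thinmx0 y).
split=> //.
- by case=> // i; exact: zero_flat.
- by case=> // i _ x; exact: Z0.
- by move=> x; exists x.
- by move=> y; split=> [/= ->|[_ <-]] //; exists 0.
- by move=> i y; split=> // _; exists 0; exact: Z0.
Qed.

Lemma has_flat_resolutionS (M F : lmodType A) (e : {linear F -> M}) n :
  flat F -> (forall x, exists y, e y = x) ->
  has_flat_resolution (submod (ker_sub e)) n -> has_flat_resolution M n.+1.
Proof.
move=> flatF e_surj [G [d [f [flatG G0 f_surj kerf kerd]]]].
pose f' : {linear G 0 -> F} := submod_val (S := ker_sub e) \o f.
pose H i : lmodType A := if i is j.+1 then G j else F.
pose h i : {linear H i.+1 -> H i} :=
  match i return {linear H i.+1 -> H i} with 0 => f' | j.+1 => d j end.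
exists H, h, e; split=> //.
- by case.
- by case=> // i; exact: G0.
- move=> y; split=> [ey|[z <-]]; last exact: (submod_valP (f z)).
  by have [z fz] := f_surj (submod_in (S := ker_sub e) ey); exists z; rewrite /= fz.
- case=> [|i] y; last exact: kerd.
  split=> [/= fy|/kerf /= fy]; last by rewrite /= fy linear0.
  by apply/kerf; apply: val_inj; rewrite [LHS]fy linear0.
Qed.

(** Induction along free covers: passing to the kernel of the cover lowers the Tor index, until the
    kernel itself is flat. *)
Lemma tor_zero_has_flat_resolution n (M : lmodType A) :
  tor_zero n (fun _ : M => True) -> has_flat_resolution M n.
Proof.
elim: n M => [|n IH] M Tn; first exact/flat_has_flat_resolution/tor_zero_flat.
pose e : {linear free_on M -> M} := @free_eval A M.
have flatF := @free_mxflat A M.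
apply: (has_flat_resolutionS (e := e)).
- by apply: eqflat_flat; exact: mxflat_eqflat.
- exact: free_eval_surj.
apply: IH => c x _ Dx.
have [|||y ey xy] := @tor_zero_ker _ _ _ e flatF n _ c (fun k => val (x k)).
- rewrite (_ : (fun _ => _) = fun=> True) //; apply/funext => z.
  by apply/propext; split=> // _; exact: free_eval_surj.
- by move=> k; exact: (submod_valP (x k)).
- rewrite -[LHS]/(comb _ (submod_val (S := ker_sub e) \o x)) -linear_comb Dx.
  by apply/funext => k; exact: linear0.
exists (fun k => submod_in (S := ker_sub e) (ey k)) => //.
apply/funext => k; apply: val_inj; move/(congr1 (@^~ k)): xy => ->.
rewrite -[RHS]/((submod_val (S := ker_sub e) \o comb _ _) k) linear_comb.
by congr comb.
Qed.

End Resolutions.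

(** * Local rings *)

Section LocalRing.
Variables (A : comPzRingType) (m : A -> Prop).
Hypotheses (m0 : m 0) (mD : forall x y, m x -> m y -> m (x + y))
  (mM : forall a x, m x -> m (a * x)) (m1 : ~ m 1)
  (m_unit : forall x, ~ m x -> exists y, x * y = 1).

(** Congruence modulo [m] respects sums and products, so no residue field has to be formed. *)
Lemma det_congr n (U V : 'M[A]_n) :
  (forall i j, m (U i j - V i j)) -> m (\det U - \det V).
Proof.
move=> UV; pose K x y := m (x - y).
have KD x x' y y' : K x y -> K x' y' -> K (x + x') (y + y').
  by move=> h h'; rewrite /K opprD addrACA; exact: mD.
have KM x x' y y' : K x y -> K x' y' -> K (x * x') (y * y').
  move=> h h'; rewrite /K.
  have -> : x * x' - y * y' = x' * (x - y) + y * (x' - y').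
    by rewrite !mulrBr addrA (mulrC x') (mulrC x' y) subrK.
  by apply: mD; exact: mM.
rewrite /determinant -/(K _ _); apply: big_ind2 => [||s _].
- by rewrite /K subrr.
- by move=> ? ? ? ?; exact: KD.
- apply: (KM); first by rewrite /K subrr.
  by apply: big_ind2 => [||i _]; [rewrite /K subrr| |exact: UV] => // ? ? ? ?;
    exact: KM.
Qed.

Section Pivot.
Variables (b a : nat) (D : 'M[A]_(b.+1, a)) (i0 : 'I_b.+1) (j0 : 'I_a) (y : A).
Hypothesis Dy : D i0 j0 * y = 1.

(** The rows form a basis of the kernel of column [j0] of [D]: the invertible entry at [i0]
    determines the coordinate [i0] from the others. *)
Definition pivot_mx : 'M[A]_(b, b.+1) := \matrix_(k, l)
  (if l == i0 then - (D (lift i0 k) j0 * y) else (l == lift i0 k)%:R).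

Lemma pivot_mx_lift k l : pivot_mx k (lift i0 l) = (k == l)%:R.
Proof. by rewrite mxE eq_sym (negPf (neq_lift _ _)) (inj_eq lift_inj) eq_sym. Qed.

Lemma comb_pivot (M : lmodType A) (x : 'I_b.+1 -> M) :
  comb D x j0 = 0 -> x = comb pivot_mx (fun k => x (lift i0 k)).
Proof.
move=> Dx; apply/funext => l; rewrite /comb.
have [k ->|->] := unliftP i0 l.
  rewrite (bigD1 k) //= pivot_mx_lift eqxx scale1r big1 ?addr0 // => k' kk'.
  by rewrite pivot_mx_lift (negPf kk') scale0r.
have : y *: comb D x j0 = 0 by rewrite Dx scaler0.
rewrite /comb (bigD1_ord i0) //= scalerDr scalerA mulrC Dy scale1r.
move/eqP; rewrite addr_eq0 => /eqP ->; rewrite scaler_sumr -sumrN.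
by apply: eq_bigr => k _; rewrite mxE eqxx scaleNr scalerA mulrC.
Qed.

Lemma mulmx_pivot c (E : 'M[A]_(c, b.+1)) :
  E *m D = 0 -> E = (\matrix_(i, k) E i (lift i0 k)) *m pivot_mx.
Proof.
move=> ED; apply/matrixP => i l.
have := @comb_pivot (A^o : lmodType A) (fun k => E i k).
have -> : comb D ((fun k => E i k) : 'I_b.+1 -> A^o) j0 = (E *m D) i j0.
  by rewrite mxE; apply: eq_bigr => k _; rewrite mulrC.
rewrite ED mxE => /(_ erefl)/(congr1 (@^~ l)) /= ->; rewrite mxE.
by apply: eq_bigr => k _; rewrite [X in _ = X * _]mxE mulrC.
Qed.

End Pivot.

(* Nakayama-type splitting: if the reduction modulo m of the complex
   A^c -> A^b -> A^a is exact, the complex splits at A^b. *)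
Lemma exact_mod_max c b a (E : 'M[A]_(c, b)) (D : 'M_(b, a)) :
  E *m D = 0 ->
  (forall v : 'rV_b, (forall j, m ((v *m D) 0 j)) ->
    exists w : 'rV_c, forall j, m ((v - w *m E) 0 j)) ->
  forall (M : lmodType A) (x : 'I_b -> M), comb D x = 0 ->
  exists y, x = comb E y.
Proof.
elim: b E D => [|b IH] E D ED modE M x Dx.
  by exists (fun=> 0); apply/funext => -[].
(* A unit entry of [D] splits off a rank one summand of A^b; the induction hypothesis applies to the
   kernel of its column. *)
have [[i0 [j0 Dij]]|Dm] := pselect (exists i j, ~ m (D i j)).
  have [y Dy] := m_unit Dij; set P := pivot_mx D i0 j0 y.
  set E' := \matrix_(i, k) E i (lift i0 k).
  have EP : E = E' *m P by exact: mulmx_pivot ED.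
  have xP : x = comb P (fun k => x (lift i0 k)).
    by apply: comb_pivot => //; rewrite Dx.
  have [|||z xz] := IH E' (P *m D) _ _ M (fun k => x (lift i0 k)).
  - by rewrite mulmxA -EP.
  - move=> v vD; have [|w vw] := modE (v *m P); first by rewrite -mulmxA.
    exists w => k; move: (vw (lift i0 k)); rewrite !mxE.
    rewrite (bigD1 k) //= pivot_mx_lift eqxx mulr1 big1 ?addr0 => [|k' kk'].
      by under [X in _ -> m (_ - X)]eq_bigr do rewrite mxE.
    by rewrite pivot_mx_lift (negPf kk') mulr0.
  - by rewrite combM -xP.
  - by exists z; rewrite xP xz -combM -EP.
have {}Dm i j : m (D i j).
  by apply: contrapT => Dij; apply: Dm; exists i, j.
(* Now [D] is zero modulo [m], so [E] is onto modulo [m]. Hence H E is congruent to the identity,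
   its determinant is a unit, and [E] has a left inverse. *)
have /choice[h hE] i : exists w : 'rV_c, forall j, m ((delta_mx 0 i - w *m E) 0 j).
  apply: modE => j; rewrite mxE; apply: big_ind => //.
  by move=> k _; exact: mM.
pose H := \matrix_i h i; have det_unit : ~ m (\det (H *m E)).
  move=> mdet; apply: m1; rewrite -(det1 A b.+1) -[\det _](subrK (\det (H *m E))).
  apply: mD => //; apply: det_congr => i j; move: (hE i j); rewrite !mxE.
  rewrite eqxx (eq_sym j i) /=; congr (m (_ - _)).
  by apply: eq_bigr => k _; rewrite mxE.
have [d dP] := m_unit det_unit.
exists (comb (d *: \adj (H *m E) *m H) x).
rewrite -combM -mulmxA -scalemxAl mul_adj_mx -mul_scalar_mx -scalar_mxM.
by rewrite mulrC dP comb1mx.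
Qed.

Hypothesis coh : mxcoherent A.

Lemma exact_mod_max_resolution n :
  (forall (c : chain A) (v : 'rV_(rk c n.+1)),
    (forall j, m ((v *m chain_mx c n) 0 j)) ->
    exists w, forall j, m ((v - w *m chain_mx c n.+1) 0 j)) ->
  forall M : lmodType A, has_flat_resolution M n.
Proof.
move=> modm M; apply: tor_zero_has_flat_resolution => // c x _ Dx.
have [y xy] := exact_mod_max (chain_exact c n).1 (@modm c) Dx.
by exists y.
Qed.

End LocalRing.

(** * Coherence in terms of matrices *)

Section Coherence.
Variable A : comPzRingType.

(** The row space of [D] is a finitely generated submodule of A^p, hence has a finite presentation,
    with generators [F] and relations [G]. Relations between the rows of [D] are obtained by
    comparing the two generating families. *)
Lemma coherent_mxcoherent : coherent A -> mxcoherent A.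
Proof.
move=> coh q p D; pose phi : {linear 'rV[A]_q -> 'rV[A]_p} := mulmxr D.
pose N := submod (im_sub phi).
have phi_im v : im_sub phi (phi v) by exists v.
have corestr_lin : linear (fun v => submod_in (phi_im v)).
  by move=> a u v; apply: val_inj; rewrite /= mulmxDl scalemxAl.
have [||r [n [g [f [f_surj kerf]]]]] := coh ('rV[A]_p : lmodType A) _ N.
- exists 0%N, p, (mulmxr (0 : 'M_(0, p))), idfun; split=> [x|u]; first by exists x.
  split=> [/= ->|[v <-]]; last by rewrite /= mulmx0.
  by exists 0; rewrite /= mulmx0.
- exists q, (linear_pack corestr_lin) => x; have [v vx] := submod_valP x.
  by exists v; apply: val_inj.
pose vf : {linear 'rV[A]_n -> 'rV[A]_p} := submod_val (S := im_sub phi) \o f.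
pose F := lin1_mx vf; pose G := lin1_mx g.
have FE u : u *m F = vf u := mul_rV_lin1 vf u.
have GE u : u *m G = g u := mul_rV_lin1 g u.
have F0 (u : 'rV_n) : u *m F = 0 -> exists v, u = v *m G.
  rewrite FE => fu; have /kerf[v <-] : f u = 0.
    by apply: val_inj; rewrite [LHS]fu linear0.
  by exists v; rewrite GE.
have GF : G *m F = 0.
  apply/row_matrixP => i; rewrite row_mul row0 rowE GE FE.
  have : f (g (delta_mx 0 i)) = 0 by apply/kerf; exists (delta_mx 0 i).
  by move=> fg; rewrite [LHS](congr1 val fg).
have /choice[al alP] i : exists u, vf u = row i D.
  have [u fu] := f_surj (submod_in (phi_im (delta_mx 0 i))).
  by exists u; rewrite [LHS](congr1 val fu) /= -rowE.
have /choice[be beP] i : exists v, v *m D = row i F.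
  have [v vP] := submod_valP (f (delta_mx 0 i)).
  by exists v; rewrite rowE FE [LHS]vP.
set a := \matrix_i al i; set b := \matrix_i be i.
have aF : a *m F = D.
  by apply/row_matrixP => i; rewrite row_mul rowK FE alP.
have bD : b *m D = F by apply/row_matrixP => i; rewrite row_mul rowK beP.
(* A relation v splits as v (1 - a b) + (v a) b, and v a is a relation between the rows of [F],
   hence a combination of the rows of [G]. *)
exists (q + r)%N, (col_mx (1%:M - a *m b) (G *m b)); split.
  rewrite mul_col_mx mulmxBl mul1mx -!mulmxA bD aF GF subrr.
  exact: col_mx0.
move=> v vD; have [|w vaw] := F0 (v *m a); first by rewrite -mulmxA aF.
exists (row_mx v w); rewrite mul_row_col mulmxA -vaw mulmxBr mulmx1 mulmxA.
by rewrite subrK.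
Qed.

End Coherence.

(** * The completion of a domain *)

Section CompletionTheory.
Variable R : idomainType.
Implicit Types (r s t : {r : R | r != 0}) (h g : Rcompletion R).

Lemma pquot_eq0 (r x : R) : \pi_(pquot r) x = 0 <-> exists a, x = r * a.
Proof.
have -> : 0 = \pi_(pquot r) 0.
  by apply: (addrI (\pi_(pquot r) 0)); rewrite -pi_pquotD !addr0.
split=> [/pquotP|xr]; first by rewrite subr0 => /asboolP.
by apply/pquotP; rewrite subr0; apply/asboolP.
Qed.

Definition completion_at h r : pquot (val r) := Rcompletion_val h r.

Lemma completion_proj h r s a : val r \in principal (val s) ->
  completion_at h r = \pi_(pquot (val r)) a ->
  completion_at h s = \pi_(pquot (val s)) a.
Proof.
move=> rs hr; have /compatibleP/(_ r s rs) := valP h.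
by rewrite [X in pquot_proj _ X]hr pquot_projE.
Qed.

Lemma completion_ext h g : (forall s, completion_at h s = completion_at g s) -> h = g.
Proof. by move=> hg; apply/val_inj/functional_extensionality_dep. Qed.

Let compl_compatible (x : R) :
  compatible ((fun r => \pi_(pquot (val r)) x) : pquot_prod R).
Proof. by apply/compatibleP => r s rs; exact: pquot_projE. Qed.

Definition compl (x : R) : Rcompletion R := RCompletion (compl_compatible x).

Lemma compl_is_zmod_morphism : zmod_morphism compl.
Proof. by move=> x y; apply: completion_ext => r; exact: pi_pquotB. Qed.

Lemma compl_is_monoid_morphism : monoid_morphism compl.
Proof. by split=> [|x y]; apply: completion_ext => r //; exact: pi_pquotM. Qed.

HB.instance Definition _ :=
  GRing.isZmodMorphism.Build R (Rcompletion R) compl compl_is_zmod_morphism.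
HB.instance Definition _ :=
  GRing.isMonoidMorphism.Build R (Rcompletion R) compl compl_is_monoid_morphism.

Let mulnz r s : val r * val s != 0.
Proof. by rewrite mulf_neq0 ?(valP r) ?(valP s). Qed.

Let mulix r s : {r : R | r != 0} := exist _ (val r * val s) (mulnz r s).

Let mulixl r s : val (mulix r s) \in principal (val r).
Proof. by apply/asboolP; exists (val s). Qed.

Let mulixr r s : val (mulix r s) \in principal (val s).
Proof. by apply/asboolP; exists (val r); rewrite mulrC. Qed.

(** The kernel of the projection to R/rR is generated by r. The quotient of h by r is read off at
    the index r s, where division by r leaves an element well defined modulo s. *)
Lemma compl_dvd h r : completion_at h r = 0 -> exists g, h = compl (val r) * g.
Proof.
move=> hr0; have /choice[b hb] s : exists b,
    completion_at h (mulix r s) = \pi_(pquot (val (mulix r s))) (val r * b).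
  have hrs := esym (reprK (completion_at h (mulix r s))).
  have := completion_proj (mulixl r s) hrs; rewrite hr0 => /esym/pquot_eq0[b bE].
  by exists b; rewrite -bE.
have gc : compatible ((fun s => \pi_(pquot (val s)) (b s)) : pquot_prod R).
  apply/compatibleP => s t st; rewrite pquot_projE //; apply/pquotP.
  have st' : val (mulix r s) \in principal (val (mulix r t)).
    by have /asboolP[a sE] := st; apply/asboolP; exists a; rewrite /= sE mulrA.
  have := completion_proj st' (hb s); rewrite hb => /esym/pquotP/asboolP[a].
  rewrite -mulrBr -mulrA => /(mulfI (valP r)) bE; apply/asboolP.
  by exists a.
exists (RCompletion gc); apply: completion_ext => s.
by rewrite (completion_proj (mulixr r s) (hb s)); exact: pi_pquotM.
Qed.

Lemma compl_approx (r : R) h : r != 0 -> exists c g, h = compl c + compl r * g.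
Proof.
move=> r0; pose i : {r : R | r != 0} := exist _ r r0.
have [|g hg] := @compl_dvd (h - compl (repr (completion_at h i))) i.
  rewrite -[LHS]/(completion_at h i - \pi_(pquot r) (repr (completion_at h i))).
  by rewrite reprK subrr.
by exists (repr (completion_at h i)), g; rewrite -hg addrC subrK.
Qed.

Lemma compl_regular (r : R) h : r != 0 -> compl r * h = 0 -> h = 0.
Proof.
move=> r0; pose i : {r : R | r != 0} := exist _ r r0.
move=> rh0; apply: completion_ext => s.
have hE := esym (reprK (completion_at h (mulix i s))).
rewrite (completion_proj (mulixr i s) hE).
have : \pi_(pquot (val (mulix i s))) (r * repr (completion_at h (mulix i s))) = 0.
  rewrite pi_pquotM reprK.
  exact: (congr1 (fun z : Rcompletion R => completion_at z (mulix i s)) rh0).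
move=> /pquot_eq0[a /=]; rewrite -mulrA => /(mulfI r0) ->.
by apply/pquot_eq0; exists a.
Qed.

Lemma compl_pure (r c : R) h : r != 0 -> compl c = compl r * h ->
  exists a, c = r * a.
Proof.
move=> r0; pose i : {r : R | r != 0} := exist _ r r0.
move=> /(congr1 (fun z : Rcompletion R => completion_at z i)) crh; apply/pquot_eq0.
transitivity (\pi_(pquot r) r * completion_at h i); first exact: crh.
rewrite (_ : \pi_(pquot r) r = 0) ?mul0r //.
by apply/pquot_eq0; exists 1; rewrite mulr1.
Qed.

(** Inverses are unique, so componentwise inverses are compatible. *)
Lemma completion_unit h : (forall s, exists u, completion_at h s * u = 1) ->
  exists g, h * g = 1.
Proof.
move=> hu; pose g : pquot_prod R := fun s => projT1 (cid (hu s)).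
have hg s : completion_at h s * g s = 1 by rewrite /g; case: cid.
have gc : compatible g.
  apply/compatibleP => r s rs.
  have hs : pquot_proj (val s) (completion_at h r) = completion_at h s.
    by have /compatibleP := valP h; apply.
  rewrite -[LHS]mulr1 -(hg s) mulrA -[in X in X * g s]hs -pquot_projM //.
  by rewrite [g r * _]mulrC hg pquot_proj1 // mul1r.
by exists (RCompletion gc); apply: completion_ext => s; exact: hg.
Qed.

End CompletionTheory.

(** * Weak dimension and change of rings *)

Section WdimEq.

Let fds (A : comPzRingType) := [set x | exists M : lmodType A, x = fd M]%classic.

Let ubound_fds (A : comPzRingType) (x : \bar int) : ubound (fds A) x <->
  (x = +oo%E \/ exists2 n : nat, x = n%:Z%:E &
     forall M : lmodType A, has_flat_resolution M n).
Proof.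
split=> [xub|[->|[n -> Mn]]]; last 2 first.
- by move=> y _; exact: leey.
- by move=> _ [M ->]; exact/fdP.
have x_fd (M : lmodType A) : (fd M <= x)%E by apply: xub; exists M.
have x0 : (0%:E <= x)%E.
  apply: le_trans (x_fd A^o); case: (fd_spec A^o) => [[n [-> _ _]]|[-> _]].
    by rewrite lee_fin.
  exact: leey.
case: x x0 x_fd {xub} => [[n|n]|//|//] // _ x_fd; last by left.
by right; exists n => // M; exact/fdP.
Qed.

(** A supremum is selected from the set of least upper bounds, which depends only on the upper
    bounds. By [ubound_fds] these are +oo and the n for which every module has a flat resolution of
    length n. *)
Lemma wdim_eq (A B : comPzRingType) :
  (forall n, (forall M : lmodType A, has_flat_resolution M n) <->
             (forall M : lmodType B, has_flat_resolution M n)) ->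
  wdim A = wdim B.
Proof.
move=> AB; rewrite /wdim -/(fds A) -/(fds B) /supremum.
have nz (C : comPzRingType) : (fds C == set0) = false.
  by apply/negP => /eqP/seteqP[/(_ (fd C^o)) h _]; apply: h; exists C^o.
rewrite !nz; congr xget; rewrite /supremums.
suff -> : ubound (fds A) = ubound (fds B) by [].
apply/funext => x; apply/propext; split=> /ubound_fds xP; apply/ubound_fds.
  by case: xP => [|[n -> /AB Bn]]; [left|right; exists n].
by case: xP => [|[n -> /AB An]]; [left|right; exists n].
Qed.

End WdimEq.

(** A copy of [V] indexed by [phi], so that it can carry the action of [S] without a clash with that
    of [B]. *)
Definition restr (S B : comPzRingType) (phi : {rmorphism S -> B})
  (V : lmodType B) : Type := V.

Section Restriction.
Variables (S B : comPzRingType) (phi : {rmorphism S -> B}).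

Local Notation restr := (restr phi).

Section RestrictionModule.
Variable V : lmodType B.
HB.instance Definition _ := GRing.Zmodule.on (restr V).

Definition restr_scale (a : S) (x : restr V) : restr V := phi a *: (x : V).

Lemma restr_scaleA a b x : restr_scale a (restr_scale b x) = restr_scale (a * b) x.
Proof. by rewrite /restr_scale scalerA rmorphM. Qed.
Lemma restr_scale1 : left_id 1 restr_scale.
Proof. by move=> x; rewrite /restr_scale rmorph1 scale1r. Qed.
Lemma restr_scaleDr : right_distributive restr_scale +%R.
Proof. by move=> a x y; exact: scalerDr. Qed.
Lemma restr_scaleDl x : {morph restr_scale^~ x : a b / a + b}.
Proof. by move=> a b; rewrite /restr_scale rmorphD; exact: scalerDl. Qed.

HB.instance Definition _ := GRing.Zmodule_isLmodule.Build S (restr V)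
  restr_scaleA restr_scale1 restr_scaleDr restr_scaleDl.

End RestrictionModule.

Lemma restr_linear (V W : lmodType B) (f : {linear V -> W}) :
  linear (f : restr V -> restr W).
Proof. by move=> a x y; exact: linearP. Qed.

Hypothesis flatB : mxflat (restr B^o).

Lemma restr_rV_mxflat a : mxflat (restr 'rV[B]_a).
Proof.
move=> r q p E D ED x Dx.
have /choice[y yP] j : exists y : 'I_r -> restr B^o,
    (fun k => (x k : 'rV_a) 0 j) = comb E y.
  apply: flatB ED _ _; apply/funext => i.
  transitivity ((comb D x i : 'rV[B]_a) 0 j); last by rewrite Dx mxE.
  rewrite /comb summxE.
  by apply: eq_bigr => k _; rewrite mxE.
exists (fun k => \row_j y j k); apply/funext => k; apply/rowP => j.
rewrite /comb summxE [LHS](congr1 (@^~ k) (yP j)).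
by apply: eq_bigr => i _; rewrite !mxE.
Qed.

Hypothesis coh : mxcoherent S.

(** Restricted to [S], a chain over [B] is an exact sequence of flat modules, to which [syzygy_pure]
    applies. The cokernel [P] of its last map serves as the resolved module. *)
Lemma chain_pure n (c : chain B) :
  (forall M : lmodType S, has_flat_resolution M n) ->
  forall q (a : 'I_q -> S) (u : 'I_q -> 'rV[B]_(rk c n)) (v : 'rV_(rk c n.+1)),
  v *m chain_mx c n = \sum_k phi (a k) *: u k ->
  exists (x : 'I_q -> 'rV[B]_(rk c n.+1)) w,
    v = \sum_k phi (a k) *: x k + w *m chain_mx c n.+1.
Proof.
move=> resS q a u v va.
pose F i : lmodType S := restr 'rV[B]_(rk c i).
pose mulr i : {linear 'rV[B]_(rk c i.+1) -> 'rV[B]_(rk c i)} := mulmxr (chain_mx c i).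
pose d i : {linear F i.+1 -> F i} := linear_pack (restr_linear (mulr i)).
pose P := quomod (im_sub (d 0%N)).
have [||||x [w vE]] := @syzygy_pure S coh n F d P (quomod_pi (im_sub (d 0%N)))
  _ _ _ _ q a u v va.
- by move=> i; exact: restr_rV_mxflat.
- by move=> y; exact: quomod_pi0.
- move=> i y; split=> [/(chain_exact c i).2[w ->]|[w <-]]; first by exists w.
  by rewrite /= -mulmxA (chain_exact c i).1 mulmx0.
- rewrite (_ : (fun _ => _) = fun=> True).
    exact: has_flat_resolution_tor_zero.
  by apply/funext => x; apply/propext; split=> // _; exact: quomod_pi_surj.
by exists x, w.
Qed.

End Restriction.

(** This allows [chain_pure] to be used with [S = B]. *)
Lemma regular_mxflat (A : comPzRingType) :
  mxflat (restr (idfun : {rmorphism A -> A}) A^o).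
Proof.
move=> r q p E D [_ ED] x Dx; have [|w xw] := ED (\row_k x k).
  apply/rowP => j; rewrite !mxE -[RHS](congr1 (@^~ j) Dx).
  by apply: eq_bigr => k _; rewrite mxE mulrC.
exists (fun i => w 0 i); apply/funext => k.
move/rowP/(_ k): xw; rewrite !mxE => ->.
by apply: eq_bigr => i _; rewrite mulrC.
Qed.

(** * Units of a quasi-local ring *)

Section QuasiLocal.
Variables (R : comNzRingType) (m : {pred R}).
Hypothesis qlm : quasi_local m.

Lemma quasi_local_unit x : x \notin m -> exists y, x * y = 1.
Proof.
move=> xm; apply: contrapT => nx.
(* Proper ideals containing [x], together with the empty set, which is the union of the empty
   chain. *)
pose P (J : set R) := [/\ ~ J 1, forall a u v, J u -> J v -> J (a * u + v)
  & forall u, J u -> J x /\ J 0].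
have [|J [[J1 JP Jx] Jmax]] := @Zorn_bigcup R P.
  move=> F FP Ftot; split=> [[J FJ J1]|a u v [J FJ Ju] [K FK Kv]|u [J FJ Ju]].
  - by have [] := FP _ FJ.
  - have [JK|KJ] := Ftot _ _ FJ FK.
      by exists K => //; have [_ KP _] := FP _ FK; apply: KP => //; exact: JK.
    by exists J => //; have [_ JP _] := FP _ FJ; apply: JP => //; exact: KJ.
  - by have [_ _ /(_ u Ju)[]] := FP _ FJ; split; exists J.
have xJ : J x /\ J 0.
  have [[u /Jx//]|J0] := pselect (exists u, J u).
  (* A maximal [J] is not empty: the principal ideal of the nonunit [x] would be larger. *)
  exfalso; apply: (Jmax [set y | exists a, y = x * a]%classic).
    split=> [u Ju|BJ]; first by case: J0; exists u.
    by case: J0; exists x; apply: BJ; exists 1; rewrite mulr1.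
  split=> [[a xa]|a _ _ [b ->] [c ->]|_ _].
  - by apply: nx; exists a.
  - by exists (a * b + c); rewrite mulrDr mulrCA.
  - by split; [exists 1; rewrite mulr1 | exists 0; rewrite mulr0].
pose j : {pred R} := fun y => `[< J y >].
have jP y : reflect (J y) (y \in j) by exact: asboolP.
have jm : j =i m.
  apply: qlm.2; split.
    split=> [||a u v /jP Ju /jP Jv]; [exact/jP/xJ.2|exact/jP|exact/jP/JP].
  move=> K [K0 K1 KP] jK y; apply/idP/idP; last exact: jK.
  apply: contraTT => yJ; apply/negP => yK.
  apply: (Jmax [set z | z \in K]%classic).
    split=> [z /jP/jK //|KJ]; case/negP: yJ; exact/jP/KJ.
  split=> [/=|a u v /=|u _ /=]; [by apply/negP|exact: KP|].
  by split=> //; apply/jK/jP/xJ.1.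
by move: xm; rewrite -jm => /negP; apply; apply/jP/xJ.1.
Qed.

Lemma quasi_local_ideal : idealr_closed m.
Proof. by case: qlm => -[]. Qed.

End QuasiLocal.

(** * Flatness of the completion over the domain *)

Section CompletionFlat.
Variable R : idomainType.
Local Notation H := (Rcompletion R).
Local Notation phi := (@compl R).
Local Notation HR := (restr phi H^o).

(* Reduce modulo a nonzero coefficient a = D i0: H/aH = R/a allows to write the
   solution h as an R-solution plus a combination of the Koszul relations
   between a and the other coefficients. *)
Lemma completion_eqflat : eqflat HR.
Proof.
move=> q D h Dh.
have [[i0 Di0]|D0] := pselect (exists i0, D i0 0 != 0); last first.
  exists q, 1%:M, h; rewrite comb1mx mul1mx; split=> //.
  apply/matrixP => i j; rewrite ord1 mxE; apply/eqP/negPn/negP => Di.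
  by apply: D0; exists i.
set a := D i0 0 in Di0.
have /choice[c /choice[g hE]] i : exists c g, (h i : H) = phi c + phi a * g.
  exact: compl_approx.
pose G : H := - \sum_i phi (D i 0) * g i.
have DhE : \sum_i phi (D i 0) * h i = 0 :> H by exact: (congr1 (@^~ 0) Dh).
have cG : phi (\sum_i D i 0 * c i) = phi a * G.
  apply/eqP; rewrite mulrN -addr_eq0 -[X in _ == X]DhE rmorph_sum mulr_sumr.
  rewrite -big_split; apply/eqP/eq_bigr => i _ /=.
  by rewrite hE mulrDr rmorphM mulrCA.
have [e eE] := compl_pure Di0 cG.
have GE : G = phi e.
  apply/eqP; rewrite -subr_eq0; apply/eqP/(compl_regular Di0).
  by rewrite mulrBr -cG eE rmorphM subrr.
(* The rows of [K] are the Koszul relations a e_i - D_i e_i0. Since the sum of the D_i c_i is a e,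
   subtracting [e] at [i0] turns [c] into the relation [c'], and h = g K + c'. *)
pose K : 'M[R]_q := a%:M - D *m delta_mx 0 i0.
pose c' : 'rV[R]_q := \row_i c i - e *: delta_mx 0 i0.
have dD : delta_mx 0 i0 *m D = a%:M.
  by rewrite -rowE; apply/matrixP => i j; rewrite !ord1 !mxE eqxx.
exists (q + 1)%N, (col_mx K c'),
  (fun i => match fintype.split i with inl i => g i | inr _ => 1 end).
split.
  rewrite mul_col_mx /K mulmxBl -mulmxA dD mul_scalar_mx mul_mx_scalar subrr.
  suff -> : c' *m D = 0 by exact: col_mx0.
  rewrite mulmxBl -scalemxAl dD; apply/matrixP => i j; rewrite !ord1 !mxE eqxx.
  under eq_bigr do rewrite mxE mulrC.
  by rewrite eE mulrC subrr.
apply/funext => k; rewrite /comb big_split_ord /= big_ord1.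
rewrite col_mxEd (unsplitK (inr 0)).
under eq_bigr do rewrite col_mxEu (unsplitK (inl _)).
transitivity (\sum_i phi (K i k) * g i + phi (c' 0 k) : H); last first.
  by congr (_ + _); apply/esym; exact: mulr1.
under eq_bigr do rewrite !mxE big_ord1 !mxE eqxx /= rmorphB mulrBl.
rewrite big_split /= sumrN (bigD1 k) //= eqxx mulr1n big1 ?addr0; last first.
  by move=> i /negPf ->; rewrite mulr0n rmorph0 mul0r.
rewrite !mxE eqxx /= rmorphB rmorphM /= -GE /G hE.
have [_|_] := eqVneq k i0; last first.
  rewrite !mulr0n rmorph0 mulr0 subr0 big1 ?subr0 1?addrC // => i _.
  by rewrite mulr0 rmorph0 mul0r.
rewrite (_ : true%:R = 1 :> R) // (_ : phi 1 = 1); last exact: rmorph1.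
rewrite mulr1 opprK.
under [X in _ = _ - X + _]eq_bigr do rewrite mulr1.
by rewrite addrACA addNr addr0 addrC.
Qed.

Lemma completion_flat : flat HR.
Proof. exact/eqflat_flat/completion_eqflat. Qed.

Lemma completion_comb q p (D : 'M[R]_(q, p)) (h : 'I_q -> H) j :
  comb D (h : 'I_q -> HR) j = ((\row_i h i) *m map_mx phi D) 0 j.
Proof. by rewrite mxE; apply: eq_bigr => i _; rewrite !mxE mulrC. Qed.

Lemma completion_exact r q p (E : 'M[R]_(r, q)) (D : 'M_(q, p)) :
  exact_mx E D -> exact_mx (map_mx phi E) (map_mx phi D).
Proof.
move=> ED; split; first by rewrite -map_mxM ED.1 map_mx0.
move=> v vD; have [|y vy] := flat_mxflat completion_flat ED (x := fun i => v 0 i : HR).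
  apply/funext => j; rewrite completion_comb (_ : \row_i v 0 i = v) ?vD ?mxE //.
  by apply/rowP => i; rewrite mxE.
exists (\row_i y i); apply/rowP => j.
by rewrite -completion_comb [LHS](congr1 (@^~ j) vy).
Qed.

(** The equational criterion is applied to the rows of [Y] one at a time, and the resulting relation
    matrices are stacked. *)
Lemma completion_syzygies r q p (D : 'M[R]_(q, p)) (Y : 'M[H]_(r, q)) :
  Y *m map_mx phi D = 0 -> exists s (E : 'M[R]_(s, q)) (W : 'M[H]_(r, s)),
  E *m D = 0 /\ Y = W *m map_mx phi E.
Proof.
elim: r Y => [|r IH] Y YD.
  by exists 0%N, 0, 0; split; [exact: mul0mx | rewrite (flatmx0 Y) [RHS]flatmx0].
move: Y YD; rewrite -[r.+1]/(1 + r)%N => Y; rewrite -[Y]vsubmxK mul_col_mx.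
set u := usubmx Y; move=> /eqP; rewrite col_mx_eq0 => /andP[/eqP uD /eqP/IH].
move=> [s [E [W [ED ->]]]].
have [|t [F [y [FD uy]]]] :=
  flat_comb completion_flat (D := D) (x := fun i => u 0 i : HR).
  apply/funext => j; rewrite completion_comb (_ : \row_i u 0 i = u) ?uD ?mxE //.
  by apply/rowP => i; rewrite mxE.
exists (t + s)%N, (col_mx F E), (block_mx (\row_i y i) 0 0 W); split.
  by rewrite mul_col_mx FD ED col_mx0.
rewrite map_col_mx mul_block_col !mul0mx addr0 add0r; congr col_mx.
by apply/rowP => j; rewrite -completion_comb [LHS](congr1 (@^~ j) uy).
Qed.

End CompletionFlat.

(** * Transfer of resolutions between the domain and its completion *)

Section Comparison.
Variables (R : idomainType) (m : {pred R}) (r0 : R).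
Hypotheses (qlm : quasi_local m) (r0m : r0 \in m) (r0_neq0 : r0 != 0).
Local Notation H := (Rcompletion R).
Local Notation phi := (@compl R).

Let mideal := quasi_local_ideal qlm.
Let mR (x : R) : Prop := x \in m.

Let mR0 : mR 0. Proof. by case: mideal. Qed.
Let mR1 : ~ mR 1. Proof. by case: mideal => _ /negP. Qed.
Let mRP a x y : mR x -> mR y -> mR (a * x + y).
Proof. by case: mideal => _ _; apply. Qed.
Let mRD x y : mR x -> mR y -> mR (x + y).
Proof. by move=> mx; rewrite -[x]mul1r; exact: mRP. Qed.
Let mRM a x : mR x -> mR (a * x).
Proof. by move=> mx; rewrite -[_ * _]addr0; exact: mRP. Qed.
Let mR_unit x : ~ mR x -> exists y, x * y = 1.
Proof. by move/negP; exact: quasi_local_unit. Qed.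

(* The maximal ideal of the completion; it does not depend on r0 because every
   element of the completion is congruent to one of R modulo r0. *)
Definition completion_max (h : H) := exists c g, c \in m /\ h = phi c + phi r0 * g.
Local Notation mH := completion_max.

Lemma completion_maxD x y : mH x -> mH y -> mH (x + y).
Proof.
move=> [c [g [cm ->]]] [d [h [dm ->]]]; exists (c + d), (g + h).
by split; [exact: mRD | rewrite rmorphD mulrDr addrACA].
Qed.

Lemma completion_maxM a x : mH x -> mH (a * x).
Proof.
move=> [c [g [cm ->]]]; have [b [h ->]] := compl_approx a r0_neq0.
exists (b * c), (phi b * g + h * (phi c + phi r0 * g)); split; first exact: mRM.
by rewrite mulrDl mulrDr (mulrDr (phi r0)) rmorphM -addrA mulrCA -mulrA.
Qed.

(** By purity, an element of R divisible by [r0] in the completion is divisible by [r0] in R. *)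
Lemma completion_max_compl x : mH (phi x) <-> x \in m.
Proof.
split=> [[c [g [cm xE]]]|xm]; last by exists x, 0; rewrite mulr0 addr0.
have [|a xc] := @compl_pure R r0 (x - c) g r0_neq0.
  by rewrite rmorphB /= xE addrAC subrr add0r.
by rewrite -(subrK c x) xc mulrC; apply: mRD cm; exact: mRM.
Qed.

Lemma completion_max0 : mH 0.
Proof. by rewrite -[0](rmorph0 phi); apply/completion_max_compl. Qed.

Lemma completion_max1 : ~ mH 1.
Proof. by rewrite -[1](rmorph1 phi) => /completion_max_compl. Qed.

Lemma completion_max_unit x : ~ mH x -> exists y, x * y = 1.
Proof.
move=> xm; apply: completion_unit => s.
(* Approximation modulo r0 s serves twice: the factor r0 shows that c is not in m, and the factor s
   that c represents x at the index s. *)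
have rs0 : r0 * val s != 0 by rewrite mulf_neq0 ?(valP s).
have [c [g xE]] := compl_approx x rs0.
have [|c' cc'] := @mR_unit c.
  move=> cm; apply: xm; exists c, (phi (val s) * g).
  by rewrite xE rmorphM -mulrA.
exists (\pi_(pquot (val s)) c').
have -> : completion_at x s = \pi_(pquot (val s)) c.
  rewrite xE; transitivity (\pi_(pquot (val s)) c +
      \pi_(pquot (val s)) (r0 * val s) * completion_at g s); first by [].
  rewrite [X in _ + X * _](_ : _ = 0) ?mul0r ?addr0 //.
  by apply/pquot_eq0; exists r0; rewrite mulrC.
by rewrite -pi_pquotM cc'.
Qed.

Lemma completion_max_sum I (r : seq I) (F : I -> H) :
  (forall i, mH (F i)) -> mH (\sum_(i <- r) F i).
Proof.
by move=> mF; apply: big_ind => //; [exact: completion_max0|exact: completion_maxD].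
Qed.

Lemma completion_max_rV a (v : 'rV[H]_a) : (forall j, mH (v 0 j)) ->
  exists q (c : 'I_q -> R) (u : 'I_q -> 'rV[H]_a),
    (forall k, c k \in m) /\ v = \sum_k phi (c k) *: u k.
Proof.
move=> /choice[c /choice[g vE]].
(* The extra index 0 collects the multiples of [r0] from all coordinates. *)
exists a.+1, (fun k => if unlift ord0 k is Some j then c j else r0).
exists (fun k => if unlift ord0 k is Some j then delta_mx 0 j else \row_j g j).
split=> [k|]; first by case: unliftP => // j _; case: (vE j).
rewrite big_ord_recl unlift_none; under eq_bigr do rewrite liftK.
apply/rowP => j; rewrite !mxE summxE (bigD1 j) //= big1 ?addr0.
  by rewrite !mxE !eqxx mulr1 addrC; case: (vE j).
by move=> k kj; rewrite !mxE eqxx /= eq_sym (negPf kj) mulr0.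
Qed.

Lemma completion_max_scale q (c : 'I_q -> H) a (u : 'I_q -> 'rV[H]_a) j :
  (forall k, mH (c k)) -> mH ((\sum_k c k *: u k) 0 j).
Proof.
move=> cm; rewrite summxE; apply: completion_max_sum => k.
by rewrite mxE mulrC; exact: completion_maxM.
Qed.

Hypothesis cohH : mxcoherent H.

(* Kernel generators over H are combinations of R-syzygies by flatness, and these
   generate the kernel over R because the maximal ideal of R generates a proper
   ideal of H. *)
Lemma mxcoherent_descent : mxcoherent R.
Proof.
move=> q p D; have [l [Y YD]] := cohH (map_mx phi D).
have [s [E [W [ED YE]]]] := completion_syzygies YD.1.
exists s, E; split=> // v vD.
have [|w vw] := YD.2 (map_mx phi v); first by rewrite -map_mxM vD map_mx0.
pose z := w *m W.
have vz : map_mx phi v = z *m map_mx phi E by rewrite vw YE mulmxA.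
(* The equation v = z E over the completion is a relation (z, 1) on the rows of E and -v, hence a
   combination of relations over R. *)
have [|t [F [y [FE zF]]]] := @completion_syzygies R 1 (s + 1) _ (col_mx E (- v))
    (row_mx z 1%:M).
  rewrite map_col_mx map_mxN mul_row_col mulmxN mul1mx -vz subrr //.
have y1 : (y *m map_mx phi F) 0 (rshift s 0) = 1 by rewrite -zF row_mxEr mxE.
(* The last coordinate 1 would lie in the maximal ideal if all last entries of [F] were in m. A
   relation with a unit as last entry can be solved for v over R. *)
have [k Fk] : exists k, ~ mR (F k (rshift s 0)).
  apply: contrapT => nF; apply: completion_max1.
  rewrite -y1 mxE; apply: completion_max_sum => i.
  rewrite mxE; apply: completion_maxM; apply/completion_max_compl.
  by apply: contrapT => Fi; apply: nF; exists i.
have [e Fe] := mR_unit Fk.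
exists (e *: lsubmx (row k F)).
have : row k F *m col_mx E (- v) = 0 by rewrite -row_mul FE row0.
rewrite -[row k F]hsubmxK mul_row_col mulmxN => /eqP; rewrite subr_eq0 => /eqP FEv.
rewrite -scalemxAl row_mxKl FEv.
rewrite [rsubmx _]mx11_scalar mul_scalar_mx scalerA !mxE mulrC.
by rewrite Fe scale1r.
Qed.

(** An element of mH F_n is a combination with coefficients in m, so purity over R puts its preimage
    in mH F_(n+1) plus a boundary. *)
Lemma completion_resolution n :
  (forall M : lmodType R, has_flat_resolution M n) ->
  forall M : lmodType H, has_flat_resolution M n.
Proof.
move=> resR; apply: (exact_mod_max_resolution completion_max0 completion_maxD
  completion_maxM completion_max1 completion_max_unit cohH) => c v.
move=> /completion_max_rV[q [a [u [am vE]]]].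
have [x [w ->]] := chain_pure (flat_mxflat (@completion_flat R))
  mxcoherent_descent resR vE.
exists w => j; rewrite addrK; apply: completion_max_scale => k.
exact/completion_max_compl.
Qed.

(** Purity over the completion is applied to the base change of the chain; the result is brought
    back to R by contracting mH to m. *)
Lemma resolution_descent n :
  (forall M : lmodType H, has_flat_resolution M n) ->
  forall M : lmodType R, has_flat_resolution M n.
Proof.
move=> resH; apply: (exact_mod_max_resolution mR0 mRD mRM mR1 mR_unit
  mxcoherent_descent) => c v vm.
pose cH := @Chain H (rk c) (fun i => map_mx phi (chain_mx c i))
  (fun i => completion_exact (chain_exact c i)).
have [|x [w vE]] := chain_pure (n := n) (c := cH) (@regular_mxflat H) cohH resH
  (a := fun j => phi ((v *m chain_mx c n) 0 j)) (u := fun j => delta_mx 0 j)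
  (v := map_mx phi v).
  by rewrite -map_mxM [LHS]row_sum_delta; apply: eq_bigr => j _; rewrite mxE.
(* Replacing [w] by entries from R costs a multiple of [r0], which lies in mH. *)
have /choice[w0 /choice[g wE]] i := compl_approx (w 0 i) r0_neq0.
have wD : w = map_mx phi (\row_i w0 i) + phi r0 *: \row_i g i.
  by apply/rowP => i; rewrite !mxE wE.
exists (\row_i w0 i) => j; apply/completion_max_compl.
have := congr1 (fun z : 'rV[H]_(rk c n.+1) => z 0 j)
  (map_mxB phi v (\row_i w0 i *m chain_mx c n.+1)).
rewrite vE wD map_mxM mulmxDl [X in _ + X - _]addrC addrA addrK mxE => ->.
rewrite mxE -scalemxAl mxE; apply: completion_maxD; last first.
  by rewrite mulrC; apply/completion_maxM/completion_max_compl.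
by apply: completion_max_scale => k; exact/completion_max_compl/vm.
Qed.

End Comparison.

Theorem proposition6p11 (R : idomainType) (m : {pred R}) :
  quasi_local m -> coherent (Rcompletion R) -> wdim R = wdim (Rcompletion R).
Proof.
move=> qlm /coherent_mxcoherent cohH; apply: wdim_eq => n.
have [[r [rm r0]]|m0] := pselect (exists r, r \in m /\ r != 0).
  split; first exact: completion_resolution qlm rm r0 cohH n.
  exact: resolution_descent qlm rm r0 cohH n.
(* If m = 0, then R is a field and its completion the zero ring; every module over either is
   flat. *)
have flat_res (A : comPzRingType) (M : lmodType A) :
    eqflat M -> has_flat_resolution M n.
  move=> flatM; apply: (@has_flat_resolutionW _ _ 0) => //.
  exact/flat_has_flat_resolution/eqflat_flat.
have runit (a : R) : a != 0 -> exists b, a * b = 1.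
  move=> a0; apply: (quasi_local_unit qlm); apply/negP => am.
  by apply: m0; exists a.
split=> _ M; apply: flat_res => q D x Dx.
  exists 0%N, 0, (fun=> 0); rewrite mul0mx; split=> //; apply/funext => k.
  have one0 : 1 = 0 :> Rcompletion R.
    apply: completion_ext => s; have [b sb] := runit _ (valP s).
    by apply/pquot_eq0; exists b.
  by rewrite -[LHS]scale1r one0 scale0r /comb big_ord0.
have [[i0 Di0]|D0] := pselect (exists i0, D i0 0 != 0); last first.
  exists q, 1%:M, x; rewrite comb1mx mul1mx; split=> //.
  apply/matrixP => i j; rewrite ord1 mxE; apply/eqP/negPn/negP => Di.
  by apply: D0; exists i.
have [b ab] := runit _ Di0.
(* As b inverts the entry at [i0], this matrix is a projection onto the relations of [D]; it fixes
   [x] because [comb D x = 0]. *)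
exists q, (1%:M - D *m (b *: delta_mx 0 i0)), x; split.
  rewrite mulmxBl mul1mx -mulmxA -scalemxAl -rowE.
  rewrite (_ : b *: row i0 D = 1%:M) ?mulmx1 ?subrr //.
  by apply/matrixP => i j; rewrite !ord1 !mxE mulrC ab eqxx.
by rewrite combDmx -mulmxN combM Dx linear0 comb1mx addr0.
Qed.
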